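(* Let $n\ge2$, $b_1,\dots,b_n\in\mathbb{R}^d$ with $\|b_i\|\le R'$ for all $i$ ($R'>0$), $B=\frac1n[b_1,\dots,b_n]^T\in\mathbb{R}^{n\times d}$, let each $g_i^*:\mathbb{R}\to\mathbb{R}\cup\{+\infty\}$ be proper, lower semicontinuous and convex, $g^*(y)=\frac1n\sum_{i=1}^n g_i^*(y_i)$, and let $\ell:\mathbb{R}^d\to\mathbb{R}\cup\{+\infty\}$ be proper, lower semicontinuous and $\sigma$-strongly convex ($\sigma\ge0$). Run the VRPDA$^2$ algorithm described in the context. Then for any $(u,v)\in\mathcal{X}\times\mathcal{Y}$ and $k=2,3,\dots,K$, $$\mathbb{E}[\mathrm{Gap}^{u,v}(\tilde x_k,\tilde y_k)]\le\frac{n(\|u-x_0\|^2+\|v-y_0\|^2)}{2A_k},$$ where $\tilde x_k=\frac1{A_k}\sum_{i=1}^k a_ix_i$ and $\tilde y_k=\frac{1}{A_k}\big(na_ky_k+\sum_{i=2}^{k-1}(na_i-(n-1)a_{i+1})y_i\big)$. Moreover, if $(x^*,y^* )$ is a primal-dual solution, then $$\mathbb{E}\Big[\frac n4\|y^*-y_k\|^2+\frac{n+\sigma A_k}{2}\|x^*-x_k\|^2\Big]\le\frac{n(\|x^*-x_0\|^2+\|y^*-y_0\|^2)}{2}.$$ In both cases $$A_k\ge\max\Big\{\frac{n-1}{2R'}\Big(1+\frac1{n-1}\Big)^k\mathbb{1}_{k\le k_0},\ \frac{(n-1)^2\sigma}{(4R')^2n}(k-k_0+n-1)^2\mathbb{1}_{k\ge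 k_0},\ \frac{n(k-K_0+n-1)}{2R'}\mathbb{1}_{k\ge K_0}\Big\},$$ where $\mathbb{1}$ is the indicator function, $K_0=\big\lceil\frac{\log n}{\log n-\log(n-1)}\big\rceil$, $k_0=\big\lceil\frac{\log B_{n,\sigma,R'}}{\log n-\log(n-1)}\big\rceil$, and $B_{n,\sigma,R'}=\frac{\sigma n(n-1)}{4R'}+\sqrt{\big(\frac{\sigma n(n-1)}{4R'}\big)^2+n^2}\ \ge n\max\{1,\frac{\sigma(n-1)}{2R'}\}$.
   Context: Norms are Euclidean; $\sigma$-strong convexity of $f$ means $f((1-\alpha)x+\alpha\hat x)\le(1-\alpha)f(x)+\alpha f(\hat x)-\frac\sigma2\alpha(1-\alpha)\|\hat x-x\|^2$ for all $x,\hat x$, $\alpha\in(0,1)$. Let $\mathcal{X}=\mathrm{dom}(\ell)$, $\mathcal{Y}=\mathrm{dom}(g^* )$, $L(x,y)=\langle Bx,y\rangle-g^*(y)+\ell(x)$, $\mathrm{Gap}^{u,v}(x,y)=L(x,v)-L(u,y)$; a primal-dual solution is a saddle point $(x^*,y^* )$ of $L$. For a vector $y$, $y_j$ or $y_{k,j}$ denotes the $j$-th coordinate (of $y$, resp. of $y_k$). VRPDA$^2$ algorithm: given $(x_0,y_0),(u,v)\in\mathcal{X}\times\mathcal{Y}$ and $K\ge2$: $\phi_0(x)=\frac12\|x-x_0\|^2$, $\psi_0(y)=\frac12\|y-y_0\|^2$, $a_0=A_0=0$, $\tilde a_1=\frac1{2R'}$; $\tilde\psi_1(y)=\psi_0(y)+\tilde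 a_1(\langle-Bx_0,y-v\rangle+g^*(y))$, $y_1=\arg\min\tilde\psi_1$; $z_1=B^Ty_1$; $\tilde\phi_1(x)=\phi_0(x)+\tilde a_1(\langle x-u,z_1\rangle+\ell(x))$, $x_1=\arg\min\tilde\phi_1$; $\psi_1=n\tilde\psi_1$, $\phi_1=n\tilde\phi_1$, $a_1=A_1=n\tilde a_1$, $a_2=\frac{a_1}{n-1}$, $A_2=A_1+a_2$. For $k=2,\dots,K$: $\bar x_{k-1}=x_{k-1}+\frac{a_{k-1}}{a_k}(x_{k-1}-x_{k-2})$; pick $j_k$ uniformly at random from $\{1,\dots,n\}$, independently of the past; $\psi_k(y)=\psi_{k-1}(y)+a_k(-b_{j_k}^T\bar x_{k-1}(y_{j_k}-v_{j_k})+g^*_{j_k}(y_{j_k}))$, $y_k=\arg\min_{y\in\mathbb{R}^n}\psi_k(y)$; $\phi_k(x)=\phi_{k-1}(x)+a_k(\langle x-u,z_{k-1}+(y_{k,j_k}-y_{k-1,j_k})b_{j_k}\rangle+\ell(x))$, $x_k=\arg\min_{x\in\mathbb{R}^d}\phi_k(x)$; $z_k=z_{k-1}+\frac1n(y_{k,j_k}-y_{k-1,j_k})b_{j_k}$; $a_{k+1}=\min\{(1+\frac1{n-1})a_k,\frac{\sqrt{n(n+\sigma A_k)}}{2R'}\}$, $A_{k+1}=A_k+a_{k+1}$. Expectations are over the random indices $j_2,j_3,\dots$. *)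

(* Defs.v *)
From HB Require Import structures.
From mathcomp Require Import all_boot all_order all_algebra.
From mathcomp Require Import all_classical all_reals all_analysis.
Set Implicit Arguments.
Unset Strict Implicit.
Unset Printing Implicit Defensive.
Import Order.TTheory GRing.Theory Num.Theory.
Import numFieldNormedType.Exports.
Local Open Scope ring_scope.

Section VRPDA.
Variable R : realType.

Definition dotv (m : nat) (x y : 'rV[R]_m) : R := \sum_(i < m) x ord0 i * y ord0 i.
Definition sqnorm (m : nat) (x : 'rV[R]_m) : R := dotv x x.
Definition enorm (m : nat) (x : 'rV[R]_m) : R := Num.sqrt (sqnorm x).

Definition proper_fun (T : Type) (f : T -> \bar R) : Prop :=
  (forall x, f x != -oo%E) /\ (exists x, (f x < +oo)%E).

Definition strongly_convex (m : nat) (sigma : R) (f : 'rV[R]_m -> \bar R) : Prop :=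
  forall (x xh : 'rV[R]_m) (al : R), 0 < al < 1 ->
    (f ((1 - al) *: x + al *: xh)%R <=
     (1 - al)%R%:E * f x + al%:E * f xh
       - (sigma / 2 * al * (1 - al) * sqnorm (xh - x))%R%:E)%E.

Definition convex_fun1 (f : R -> \bar R) : Prop :=
  forall (x xh al : R), 0 < al < 1 ->
    (f ((1 - al) * x + al * xh)%R <= (1 - al)%R%:E * f x + al%:E * f xh)%E.

Definition dom (T : Type) (f : T -> \bar R) : set T := [set x | (f x < +oo)%E].

Fixpoint steps (n : nat) (sigma Rp : R) (k : nat) : R * R :=
  let a1 := n%:R / (2 * Rp) in
  match k with
  | 0 => (0, 0)
  | 1 => (a1, a1)
  | 2 => (a1 / (n%:R - 1), a1 + a1 / (n%:R - 1))
  | k'.+1 =>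
      let p := steps n sigma Rp k' in
      let a' := Num.min ((1 + 1 / (n%:R - 1)) * p.1)
                        (Num.sqrt (n%:R * (n%:R + sigma * p.2)) / (2 * Rp)) in
      (a', p.2 + a')
  end.
Definition step_a n sigma Rp k := (steps n sigma Rp k).1.
Definition step_A n sigma Rp k := (steps n sigma Rp k).2.

(* data: b : 'I_n -> R^d ; B = (1/n) [b_1 .. b_n]^T ;  B x and B^T y *)
Definition Bmul (n d : nat) (b : 'I_n -> 'rV[R]_d) (x : 'rV[R]_d) : 'rV[R]_n :=
  \row_(i < n) (dotv (b i) x / n%:R).
Definition BTmul (n d : nat) (b : 'I_n -> 'rV[R]_d) (y : 'rV[R]_n) : 'rV[R]_d :=
  \sum_(i < n) ((y ord0 i / n%:R) *: b i).

Definition gstar (n : nat) (gs : 'I_n -> R -> \bar R) (y : 'rV[R]_n) : \bar R :=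
  ((n%:R)^-1%R%:E * \sum_(i < n) gs i (y ord0 i))%E.

Definition Lag (n d : nat) (b : 'I_n -> 'rV[R]_d) (gs : 'I_n -> R -> \bar R)
  (l : 'rV[R]_d -> \bar R) (x : 'rV[R]_d) (y : 'rV[R]_n) : \bar R :=
  ((dotv (Bmul b x) y)%:E - gstar gs y + l x)%E.

Definition Gap n d b gs l (u : 'rV[R]_d) (v : 'rV[R]_n) x y : \bar R :=
  (@Lag n d b gs l x v - @Lag n d b gs l u y)%E.

Definition saddle_point n d b gs l (xs : 'rV[R]_d) (ys : 'rV[R]_n) : Prop :=
  xs \in dom l /\ ys \in dom (gstar gs) /\
  forall x y, x \in dom l -> y \in dom (gstar gs) ->
    (@Lag n d b gs l xs y <= @Lag n d b gs l xs ys <= @Lag n d b gs l x ys)%E.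

Definition is_argmin (T : Type) (f : T -> \bar R) (x : T) : Prop :=
  forall x', (f x <= f x')%E.

(* One run of VRPDA^2 along the index sequence j (j k = j_k), with the
   iterates x, y, z given as sequences.  psi_k, phi_k are the estimate
   functions of the algorithm; the relation vrpda_run states that
   every iterate is the prescribed (arg)min / update. *)
Section Run.
Variables (n d : nat) (sigma Rp : R) (b : 'I_n -> 'rV[R]_d)
  (gs : 'I_n -> R -> \bar R) (l : 'rV[R]_d -> \bar R)
  (x0 : 'rV[R]_d) (y0 : 'rV[R]_n) (u : 'rV[R]_d) (v : 'rV[R]_n)
  (j : nat -> 'I_n)
  (x : nat -> 'rV[R]_d) (y : nat -> 'rV[R]_n) (z : nat -> 'rV[R]_d).

Let a k := step_a n sigma Rp k.
Definition at1 : R := 1 / (2 * Rp).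

Definition psi_t1 (w : 'rV[R]_n) : \bar R :=
  ((sqnorm (w - y0) / 2)%R%:E +
   at1%:E * ((dotv (- Bmul b x0) (w - v))%R%:E + gstar gs w))%E.
Definition phi_t1 (w : 'rV[R]_d) : \bar R :=
  ((sqnorm (w - x0) / 2)%R%:E +
   at1%:E * ((dotv (w - u) (z 1))%R%:E + l w))%E.

Definition xbar (k : nat) : 'rV[R]_d :=
  x k + (a k / a k.+1) *: (x k - x k.-1).

Fixpoint psi (k : nat) : 'rV[R]_n -> \bar R :=
  match k with
  | 0 => fun w => (sqnorm (w - y0) / 2)%R%:E
  | 1 => fun w => (n%:R%:E * psi_t1 w)%E
  | k'.+1 => fun w =>
      (psi k' w + (a k)%:E *
        ((- dotv (b (j k)) (xbar k') * (w ord0 (j k) - v ord0 (j k)))%R%:E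
         + gs (j k) (w ord0 (j k))))%E
  end.

Fixpoint phi (k : nat) : 'rV[R]_d -> \bar R :=
  match k with
  | 0 => fun w => (sqnorm (w - x0) / 2)%R%:E
  | 1 => fun w => (n%:R%:E * phi_t1 w)%E
  | k'.+1 => fun w =>
      (phi k' w + (a k)%:E *
        ((dotv (w - u) (z k' + (y k ord0 (j k) - y k' ord0 (j k)) *: b (j k)))%R%:E
         + l w))%E
  end.

Definition vrpda_run (K : nat) : Prop :=
  [/\ x 0 = x0, y 0 = y0,
      is_argmin psi_t1 (y 1), z 1 = BTmul b (y 1) &
      is_argmin phi_t1 (x 1)] /\
      forall k, (2 <= k <= K)%N ->
        [/\ is_argmin (psi k) (y k), is_argmin (phi k) (x k) &
            z k = z k.-1 + ((y k ord0 (j k) - y k.-1 ord0 (j k)) / n%:R) *: b (j k)].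
End Run.

Definition xtilde n d sigma Rp (x : nat -> 'rV[R]_d) (k : nat) : 'rV[R]_d :=
  (step_A n sigma Rp k)^-1 *: \sum_(1 <= i < k.+1) (step_a n sigma Rp i *: x i).
Definition ytilde n sigma Rp (y : nat -> 'rV[R]_n) (k : nat) : 'rV[R]_n :=
  (step_A n sigma Rp k)^-1 *: (
    (n%:R * step_a n sigma Rp k) *: y k +
     \sum_(2 <= i < k)
       ((n%:R * step_a n sigma Rp i - (n%:R - 1) * step_a n sigma Rp i.+1) *: y i)).

(* Random indices j_2, ..., j_K, i.i.d. uniform on 'I_n: sample space
   Omega = {ffun 'I_K.+1 -> 'I_n} with the uniform probability; j_k = w k.
   (coordinates 0 and 1 are unused dummies, which does not change any
   expectation.)  Expectations are finite averages. *)
Definition Omega (n K : nat) := {ffun 'I_K.+1 -> 'I_n}.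
Definition jseq (n K : nat) (w : Omega n K) (k : nat) : 'I_n := w (inord k).
Definition Exp (n K : nat) (F : Omega n K -> R) : R :=
  (\sum_(w : Omega n K) F w) / #|{: Omega n K}|%:R.
Definition Expe (n K : nat) (F : Omega n K -> \bar R) : \bar R :=
  ((\sum_(w : Omega n K) F w) * (#|{: Omega n K}|%:R^-1)%R%:E)%E.

Definition ind01 (P : bool) : R := if P then 1 else 0.

End VRPDA.

(* Main.v *)
(** The estimate functions [psi k] and [phi k] are strongly convex with moduli
    [n] and [n + sigma * A k], so their minimal values grow at least by the new
    terms plus the quadratic growth at the previous minimizer.  Summing up, the
    coupling errors telescope because of the extrapolation in [xbar], and what
    is left is absorbed by the quadratic growth through Young's inequality,
    since [(2 * Rp * a k) ^+ 2 <= n * (n + sigma * A k.-1)].  This holds along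
    every path up to a sum of terms depending on [j_i] recentred at their mean
    over ['I_n]; uniqueness of the minimizers makes the iterates adapted, so
    that sum has expectation zero.  Jensen's inequality then turns the weighted
    sums into the gap at the averaged iterates.  The iterates do not depend on
    [(u, v)], so the bound also applies at a saddle point, where the gap is
    nonnegative.  The step sizes grow geometrically with ratio [n / (n - 1)]
    exactly as long as that power stays below [Bn], which gives the bounds on
    [A k]. *)
Require Import Defs.
From HB Require Import structures.
From mathcomp Require Import all_boot all_order all_algebra.
From mathcomp Require Import all_classical all_reals all_analysis.
From mathcomp Require Import ring lra.
Import Order.TTheory GRing.Theory Num.Theory.
Import numFieldNormedType.Exports.
Local Open Scope ring_scope.
Set Implicit Arguments.
Unset Strict Implicit.
Unset Printing Implicit Defensive.

(** * Euclidean inner product and elementary inequalities *)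

Section Vectors.
Variable R : realType.
Implicit Types m : nat.

Lemma dotvC m (x y : 'rV[R]_m) : dotv x y = dotv y x.
Proof. by apply: eq_bigr => i _; rewrite mulrC. Qed.

Lemma dotvDl m (x y w : 'rV[R]_m) : dotv (x + y) w = dotv x w + dotv y w.
Proof. by rewrite /dotv -big_split; apply: eq_bigr => i _; rewrite mxE mulrDl. Qed.

Lemma dotvZl m c (x w : 'rV[R]_m) : dotv (c *: x) w = c * dotv x w.
Proof. by rewrite /dotv mulr_sumr; apply: eq_bigr => i _; rewrite mxE mulrA. Qed.

Lemma dotvNl m (x w : 'rV[R]_m) : dotv (- x) w = - dotv x w.
Proof. by rewrite -scaleN1r dotvZl mulN1r. Qed.

Lemma dotvDr m (x y w : 'rV[R]_m) : dotv w (x + y) = dotv w x + dotv w y.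
Proof. by rewrite dotvC dotvDl !(dotvC w). Qed.

Lemma dotvZr m c (x w : 'rV[R]_m) : dotv w (c *: x) = c * dotv w x.
Proof. by rewrite dotvC dotvZl dotvC. Qed.

Lemma dotvNr m (x w : 'rV[R]_m) : dotv w (- x) = - dotv w x.
Proof. by rewrite dotvC dotvNl dotvC. Qed.

Lemma dotv0r m (w : 'rV[R]_m) : dotv w 0 = 0.
Proof. by rewrite -(scale0r 0) dotvZr mul0r. Qed.

Definition dotvE := (dotvDl, dotvDr, dotvNl, dotvNr, dotvZl, dotvZr).

Lemma sqnorm_ge0 m (x : 'rV[R]_m) : 0 <= sqnorm x.
Proof. by apply: sumr_ge0 => i _; rewrite -expr2 sqr_ge0. Qed.

Lemma sqnorm_eq0 m (x : 'rV[R]_m) : sqnorm x <= 0 -> x = 0.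
Proof.
move=> x0; have /eqP := le_anti (introT andP (conj x0 (sqnorm_ge0 x))).
rewrite psumr_eq0 => [/allP x_eq0|i _]; last by rewrite -expr2 sqr_ge0.
apply/rowP => i; rewrite mxE; apply/eqP.
by have /(_ (mem_index_enum i)) := x_eq0 i; rewrite /= mulf_eq0 orbb.
Qed.

Lemma sqnorm0 m : sqnorm (0 : 'rV[R]_m) = 0.
Proof. exact: dotv0r. Qed.

Lemma sqnormBC m (x y : 'rV[R]_m) : sqnorm (x - y) = sqnorm (y - x).
Proof. by rewrite /sqnorm !dotvE; lra. Qed.

Lemma cauchy_schwarz m (x y : 'rV[R]_m) : dotv x y ^+ 2 <= sqnorm x * sqnorm y.
Proof.
have [y0|y0] := leP (sqnorm y) 0.
  by rewrite (sqnorm_eq0 y0) dotv0r sqnorm0 mulr0 expr0n.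
(* This vector is [sqnorm y] times the component of [x] orthogonal to [y]. *)
have := sqnorm_ge0 (sqnorm y *: x - dotv x y *: y).
have -> : sqnorm (sqnorm y *: x - dotv x y *: y)
   = sqnorm y * (sqnorm x * sqnorm y - dotv x y ^+ 2).
  by rewrite /sqnorm !dotvE (dotvC y x); ring.
by rewrite pmulr_rge0 // subr_ge0.
Qed.

Lemma sqnorm_le_enorm m (x : 'rV[R]_m) (r : R) : enorm x <= r -> sqnorm x <= r ^+ 2.
Proof.
move=> xr; rewrite -[sqnorm x]sqr_sqrtr ?sqnorm_ge0//.
by rewrite ler_sqr// nnegrE ?sqrtr_ge0// (le_trans _ xr)// sqrtr_ge0.
Qed.

(** Young's inequality in product form: [s] is at most half the geometric mean of [p] and [q], hence
    at most half their arithmetic mean. *)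
Lemma sqr_le_half (s p q : R) :
  0 <= p -> 0 <= q -> 4 * s ^+ 2 <= p * q -> `|s| <= (p + q) / 4.
Proof.
move=> p0 q0 spq; rewrite -ler_sqr ?nnegrE ?divr_ge0 ?addr_ge0//.
rewrite real_normK ?num_real//.
by have := sqr_ge0 (p - q); rewrite !expr2 in spq *; lra.
Qed.

End Vectors.

(** * Strong convexity on a domain, uniqueness of minimizers and Jensen's inequality *)

Section StrongConvexity.
Variables (R : realType) (m : nat).
Implicit Types (D : 'rV[R]_m -> Prop) (f g : 'rV[R]_m -> R) (mu : R).

Definition convex_on D := forall x y al, 0 < al < 1 -> D x -> D y ->
  D ((1 - al) *: x + al *: y).

(** Stated for real-valued functions relative to a domain, which keeps extended reals out of the
    estimates; [mu = 0] is plain convexity. *)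
Definition sconvex_on D mu f := forall x y al, 0 < al < 1 -> D x -> D y ->
  f ((1 - al) *: x + al *: y) <=
  (1 - al) * f x + al * f y - mu / 2 * al * (1 - al) * sqnorm (y - x).

Definition minimizer_on D f p := D p /\ forall w, D w -> f p <= f w.

Lemma sconvexD D mu nu f g : sconvex_on D mu f -> sconvex_on D nu g ->
  sconvex_on D (mu + nu) (fun w => f w + g w).
Proof.
move=> fc gc x y al al01 Dx Dy.
have := fc _ _ _ al01 Dx Dy; have := gc _ _ _ al01 Dx Dy; lra.
Qed.

Lemma sconvexZ D mu f c : 0 <= c -> sconvex_on D mu f ->
  sconvex_on D (c * mu) (fun w => c * f w).
Proof.
move=> c0 fc x y al al01 Dx Dy.
have := ler_wpM2l c0 (fc _ _ _ al01 Dx Dy); lra.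
Qed.

Lemma sconvex_sqnorm D x0 : sconvex_on D 1 (fun w => sqnorm (w - x0) / 2).
Proof.
move=> x y al al01 Dx Dy; rewrite le_eqVlt; apply/orP; left; apply/eqP.
rewrite /sqnorm !dotvE !(dotvC x0) !(dotvC y x); lra.
Qed.

Lemma sconvex_dotvr D c q : sconvex_on D 0 (fun w => dotv (w - c) q).
Proof. by move=> x y al al01 Dx Dy; rewrite !dotvE; lra. Qed.

Lemma sconvex_ext D mu f g : f =1 g -> sconvex_on D mu f -> sconvex_on D mu g.
Proof. by move=> fg fc x y al al01 Dx Dy; rewrite -!fg; exact: fc. Qed.

(** Comparing [f p] with [f] on the segment towards [w] and dividing by [al] gives the bound with an
    extra factor [1 - al]. The limit [al -> 0] is replaced by one well-chosen [al]. *)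
Lemma sconvex_growth D mu f p w : convex_on D -> sconvex_on D mu f -> 0 <= mu ->
  minimizer_on D f p -> D w -> f p + mu / 2 * sqnorm (w - p) <= f w.
Proof.
move=> Dc fc mu0 [Dp pmin] Dw; rewrite -lerBrDl; set s := sqnorm _.
have s0 : 0 <= mu / 2 * s by rewrite mulr_ge0 ?divr_ge0 ?sqnorm_ge0.
have key al : 0 < al < 1 -> (1 - al) * (mu / 2 * s) <= f w - f p.
  move=> al01; have := fc _ _ _ al01 Dp Dw.
  have := pmin _ (Dc _ _ _ al01 Dp Dw); rewrite -/s.
  set F := f _ => F1 F2; have al0 : 0 < al by case/andP: al01.
  rewrite -(ler_pM2l al0); lra.
have [//|lt] := leP (mu / 2 * s) (f w - f p).
have s1 : 0 < mu / 2 * s + 1 by lra.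
have fwp : 0 <= f w - f p by rewrite subr_ge0 pmin.
set e := mu / 2 * s in lt s0 key s1 *; set F := f w - f p in lt fwp key *.
have e2 : 0 < 2 * e by lra.
(* For this [al] the product [(1 - al) * e] is the midpoint of [e] and [F], which exceeds [F] as
   soon as [F < e]. *)
have := key ((e - F) / (2 * e)).
rewrite divr_gt0 ?subr_gt0// ltr_pdivrMr// mul1r => /(_ _)/wrap[]; first by lra.
have -> : (1 - (e - F) / (2 * e)) * e = (e + F) / 2 by field; lra.
lra.
Qed.

Lemma sconvex_minimizer_unique D mu f p q : convex_on D -> sconvex_on D mu f ->
  0 < mu -> minimizer_on D f p -> minimizer_on D f q -> p = q.
Proof.
move=> Dc fc mu0 pm qm; have := sconvex_growth Dc fc (ltW mu0) pm qm.1.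
have := qm.2 _ pm.1 => qp pq; apply/esym/subr0_eq/sqnorm_eq0.
rewrite -(pmulr_rle0 _ (_ : 0 < mu / 2)) ?divr_gt0//; lra.
Qed.

(* A finite sum [p] of points of [D] with total weight [s], together with an
   upper bound [t] of [s * f (p / s)]; this invariant is stable under sums,
   which is Jensen's inequality. *)
Definition jensen_sum D f (s : R) (p : 'rV[R]_m) (t : R) :=
  [/\ s = 0, p = 0 & t = 0] \/
  [/\ 0 < s, D (s^-1 *: p) & s * f (s^-1 *: p) <= t].

(** A zero weight is allowed and falls in the degenerate case of [jensen_sum], since the weights of
    the dual average may vanish. *)
Lemma jensen_sum1 D f c p : 0 <= c -> D p -> jensen_sum D f c (c *: p) (c * f p).
Proof.
move=> + Dp; rewrite le_eqVlt => /predU1P[<-|c0].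
  by left; rewrite scale0r mul0r.
by right; rewrite scalerA mulVf ?gt_eqF// scale1r.
Qed.

Lemma jensen_sumD D f s p t s' p' t' : convex_on D -> sconvex_on D 0 f ->
  jensen_sum D f s p t -> jensen_sum D f s' p' t' ->
  jensen_sum D f (s + s') (p + p') (t + t').
Proof.
move=> Dc fc [[-> -> ->]|[s0 Dp fp]]; first by rewrite !add0r.
case=> [[-> -> ->]|[s0' Dp' fp']]; first by rewrite !addr0; right.
right; have ss0 : 0 < s + s' by rewrite addr_gt0.
have ss1 : s + s' != 0 by rewrite gt_eqF.
have al01 : 0 < s' / (s + s') < 1.
  by rewrite divr_gt0// ltr_pdivrMr// mul1r ltrDr.
have E : (s + s')^-1 *: (p + p') =
    (1 - s' / (s + s')) *: (s^-1 *: p) + (s' / (s + s')) *: (s'^-1 *: p').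
  rewrite !scalerA scalerDr; congr (_ *: _ + _ *: _); field;
    by rewrite ?ss1 ?gt_eqF.
split => //; first by rewrite E; exact: Dc.
rewrite E; have := fc _ _ _ al01 Dp Dp'; rewrite !mul0r subr0.
rewrite -(ler_pM2l ss0) => /le_trans; apply.
have -> : (s + s') * ((1 - s' / (s + s')) * f (s^-1 *: p) +
    s' / (s + s') * f (s'^-1 *: p')) = s * f (s^-1 *: p) + s' * f (s'^-1 *: p').
  by field.
exact: lerD.
Qed.

Lemma jensen_sum_big D f h q (c : nat -> R) (p : nat -> 'rV[R]_m) :
  convex_on D -> sconvex_on D 0 f ->
  (forall i, (h <= i < q)%N -> 0 <= c i) -> (forall i, (h <= i < q)%N -> D (p i)) ->
  jensen_sum D f (\sum_(h <= i < q) c i) (\sum_(h <= i < q) c i *: p i)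
    (\sum_(h <= i < q) c i * f (p i)).
Proof.
move=> Dc fc c0 Dp; rewrite [X in jensen_sum _ _ X]big_nat_cond.
rewrite [X in jensen_sum _ _ _ X]big_nat_cond [X in jensen_sum _ _ _ _ X]big_nat_cond.
apply: big_ind3; first by left.
  by move=> s p1 t s' p' t'; exact: jensen_sumD.
by move=> i; rewrite andbT => hiq; apply: jensen_sum1; [exact: c0|exact: Dp].
Qed.

End StrongConvexity.

(** * Step sizes: inequalities from the recursion and growth of [A k] *)

Section Steps.
Variables (R : realType) (n : nat) (sigma Rp : R).
Hypotheses (n2 : (2 <= n)%N) (Rp0 : 0 < Rp) (sigma0 : 0 <= sigma).

Local Notation a := (step_a n sigma Rp).
Local Notation A := (step_A n sigma Rp).
Local Notation N := (n%:R : R).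

Let N2 : 2 <= N. Proof. by rewrite (ler_nat _ 2). Qed.
Let Rp2 : 0 < 2 * Rp. Proof. by rewrite mulr_gt0. Qed.
Let N1 : 0 < N - 1. Proof. by have := N2; lra. Qed.

Lemma step_AS k : A k.+1 = A k + a k.+1.
Proof. by case: k => [|[|k]] //; rewrite /step_A /step_a /= add0r. Qed.

Lemma step_a1 : a 1 = N / (2 * Rp). Proof. by []. Qed.

Lemma step_a2 : a 2 = a 1 / (N - 1). Proof. by []. Qed.

Lemma step_aSSS k : a k.+3 = Num.min ((1 + 1 / (N - 1)) * a k.+2)
  (Num.sqrt (N * (N + sigma * A k.+2)) / (2 * Rp)).
Proof. by []. Qed.

Lemma step_aA_gt0 k : 0 < a k.+1 /\ 0 < A k.+1.
Proof.
have a1 : 0 < a 1 by rewrite step_a1 divr_gt0//; have := N2; lra.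
elim: k => [|k [ak Ak]]; first by rewrite step_AS add0r.
suff ak1 : 0 < a k.+2 by split => //; rewrite step_AS addr_gt0.
case: k ak Ak => [|k] ak Ak; first by rewrite step_a2 divr_gt0.
rewrite step_aSSS lt_min; apply/andP; split.
  by rewrite mulr_gt0// addr_gt0// divr_gt0.
rewrite divr_gt0// sqrtr_gt0 mulr_gt0//; first by have := N2; lra.
have := mulr_ge0 sigma0 (ltW Ak); have := N2; lra.
Qed.

Lemma step_a_gt0 k : 0 < a k.+1. Proof. exact: (step_aA_gt0 k).1. Qed.

Lemma step_A_gt0 k : 0 < A k.+1. Proof. exact: (step_aA_gt0 k).2. Qed.

Lemma step_A_ge0 k : 0 <= A k.
Proof. by case: k => [//|k]; rewrite ltW// step_A_gt0. Qed.

(** This is the condition under which Young's inequality absorbs the coupling errors. It restates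
    the second argument of the minimum; [a 1] and [a 2] are not defined by the minimum and are
    compared with [N] directly. *)
Lemma step_a_sqr k : (2 * Rp * a k.+1) ^+ 2 <= N * (N + sigma * A k).
Proof.
have NA : 0 <= N * (N + sigma * A k).
  apply: mulr_ge0; first by have := N2; lra.
  by have := mulr_ge0 sigma0 (step_A_ge0 k); have := N2; lra.
have NN : N ^+ 2 <= N * (N + sigma * A k).
  rewrite expr2 ler_pM2l ?lerDl ?mulr_ge0 ?step_A_ge0//.
  by have := N2; lra.
case: k NA NN => [|[|k]] NA NN.
- suff -> : 2 * Rp * a 1 = N by [].
  by rewrite step_a1; field; rewrite gt_eqF.
- apply: le_trans NN; rewrite step_a2 step_a1.
  have -> : 2 * Rp * (N / (2 * Rp) / (N - 1)) = N / (N - 1).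
    by field; rewrite !gt_eqF//.
  rewrite ler_sqr ?nnegrE; [|by rewrite divr_ge0// ?(ltW N1)//; have := N2; lra|by have := N2; lra].
  rewrite ler_pdivrMr//; have := N2; nra.
- rewrite -[X in _ <= X]sqr_sqrtr//.
  rewrite ler_sqr ?nnegrE ?sqrtr_ge0 ?mulr_ge0 ?(ltW Rp0) ?(ltW (step_a_gt0 _))//.
  rewrite mulrC -ler_pdivlMr// step_aSSS.
  by rewrite ge_min lexx orbT.
Qed.

(** Makes the weights of the averaged dual iterate nonnegative, as Jensen's inequality requires. *)
Lemma step_a_growth k : (N - 1) * a k.+2 <= N * a k.+1.
Proof.
have NN : 0 <= N by have := N2; lra.
case: k => [|k].
  rewrite step_a2 mulrCA divff ?gt_eqF// mulr1.
  by rewrite ler_peMl ?(ltW (step_a_gt0 _))//; have := N2; lra.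
rewrite step_aSSS.
have /(ler_wpM2l (ltW N1)) : Num.min ((1 + 1 / (N - 1)) * a k.+2)
    (Num.sqrt (N * (N + sigma * A k.+2)) / (2 * Rp)) <= (1 + 1 / (N - 1)) * a k.+2.
  by rewrite ge_min lexx.
move/le_trans; apply; rewrite mulrA.
by have -> : (N - 1) * (1 + 1 / (N - 1)) = N by field; rewrite gt_eqF.
Qed.

(** Makes the weight of [y 1] vanish in the averaged dual iterate. *)
Lemma step_a1E : a 1 = (N - 1) * a 2.
Proof. by rewrite step_a2 mulrCA divff ?gt_eqF// mulr1. Qed.

(** * Geometric, quadratic and linear regimes of [A k] *)

Let q : R := N / (N - 1).
Let c := sigma * N * (N - 1) / (4 * Rp).
(** The positive root of [X ^+ 2 = 2 * c * X + N ^+ 2], the equation at which the two arguments of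
    the minimum coincide in the geometric phase. *)
Let Bn := c + Num.sqrt (c ^+ 2 + N ^+ 2).
Let k0 : int := Num.ceil (ln Bn / (ln N - ln (N - 1))).
Let K0 : int := Num.ceil (ln N / (ln N - ln (N - 1))).

Let q1 : 1 < q. Proof. by rewrite /q ltr_pdivlMr// mul1r ltrBlDr ltrDl. Qed.
Let qE : 1 + 1 / (N - 1) = q. Proof. by rewrite /q; field; rewrite gt_eqF. Qed.
Let q0 : 0 < q. Proof. by have := q1; lra. Qed.
Let lnq : ln N - ln (N - 1) = ln q.
Proof. by rewrite /q ln_div// posrE //; have := N2; lra. Qed.
Let lnq0 : 0 < ln q. Proof. exact: ln_gt0. Qed.
Let c0 : 0 <= c.
Proof.
by rewrite divr_ge0 ?mulr_ge0// ?(ltW Rp0) ?(ltW N1)//; have := N2; lra.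
Qed.

Let N0 : 0 < N. Proof. by have := N2; lra. Qed.

Let S := Num.sqrt (c ^+ 2 + N ^+ 2).

Let SE : S ^+ 2 = c ^+ 2 + N ^+ 2.
Proof. by rewrite sqr_sqrtr// addr_ge0 ?sqr_ge0. Qed.

Let S0 : 0 <= S. Proof. exact: sqrtr_ge0. Qed.

Let cS : c <= S.
Proof. by rewrite -ler_sqr ?nnegrE// SE lerDl sqr_ge0. Qed.

Let NS : N <= S.
Proof. by rewrite -ler_sqr ?nnegrE ?(ltW N0)// SE lerDr sqr_ge0. Qed.

Let NBn : N <= Bn. Proof. by rewrite /Bn -/S; have := NS; have := c0; lra. Qed.

Let cBn : 2 * c <= Bn. Proof. by rewrite /Bn -/S; have := cS; lra. Qed.

Lemma Bn_ge : N * Num.max 1 (sigma * (N - 1) / (2 * Rp)) <= Bn.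
Proof.
rewrite maxr_pMr ?(ltW N0)// ge_max mulr1 NBn /=.
suff -> : N * (sigma * (N - 1) / (2 * Rp)) = 2 * c by [].
by rewrite /c; field; rewrite gt_eqF.
Qed.

(** Turns a comparison with the threshold index into a comparison of powers of [q]. *)
Lemma ceil_log_le (X : R) (k : nat) : 0 < X ->
  (Num.ceil (ln X / (ln N - ln (N - 1))) <= k%:Z)%R = (X <= q ^+ k).
Proof.
move=> X0; rewrite lnq ceil_le_int ler_pdivrMr// mulr_natl -lnXn//.
by rewrite ler_ln// posrE exprn_gt0.
Qed.

Let sqrt_ge (t : R) k : 0 <= t -> (2 * Rp * t) ^+ 2 <= N * (N + sigma * A k) ->
  t <= Num.sqrt (N * (N + sigma * A k)) / (2 * Rp).
Proof.
move=> t0 tA; rewrite ler_pdivlMr// mulrC.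
have Rt : 0 <= 2 * Rp * t by rewrite mulr_ge0// ltW.
rewrite -[X in X <= _](ger0_norm Rt) -sqrtr_sqr ler_sqrt//.
exact: le_trans (sqr_ge0 _) tA.
Qed.

(* [q ^+ k <= Bn] is exactly the condition under which the first argument of
   the minimum defining the step size is the smaller one. *)
Lemma geometric_phase k : q ^+ k <= Bn ->
  A k.+1 = (N - 1) / (2 * Rp) * q ^+ k.+1 /\ ((0 < k)%N -> a k.+1 = q ^+ k / (2 * Rp)).
Proof.
have A1 : A 1 = (N - 1) / (2 * Rp) * q ^+ 1.
  by rewrite step_AS add0r step_a1 /q expr1; field; rewrite !gt_eqF.
elim: k => [//|k IH] qB.
have [Ak ak] : A k.+1 = (N - 1) / (2 * Rp) * q ^+ k.+1 /\
    ((0 < k)%N -> a k.+1 = q ^+ k / (2 * Rp)).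
  by apply: IH; apply: le_trans qB; rewrite ler_weXn2l// ltW.
suff ak1 : a k.+2 = q ^+ k.+1 / (2 * Rp).
  split=> //; rewrite step_AS Ak ak1 [q ^+ k.+2]exprS.
  by move: (q ^+ k.+1) => Q; rewrite /q; field; rewrite !gt_eqF.
case: k IH ak Ak qB => [|k] _ ak Ak qB.
  by rewrite step_a2 step_a1 expr1 /q; field; rewrite !gt_eqF.
rewrite step_aSSS qE ak// mulrA -exprS; apply/min_idPl.
set Q := q ^+ k.+2 in Ak qB *.
have Q0 : 0 < Q by rewrite exprn_gt0.
apply: sqrt_ge; first by rewrite divr_ge0// ltW.
have -> : 2 * Rp * (Q / (2 * Rp)) = Q by field; rewrite gt_eqF.
have -> : N * (N + sigma * A k.+2) = N ^+ 2 + 2 * c * Q.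
  by rewrite Ak /c; field; rewrite gt_eqF.
(* The product is [N ^+ 2 + 2 * c * Q - Q ^+ 2], factored at its roots [c + S] and [c - S]. *)
have : 0 <= (Bn - Q) * (Q - c + S).
  by rewrite mulr_ge0 ?subr_ge0//; have := cS; lra.
have := SE; rewrite /Bn -/S !expr2; lra.
Qed.

(** Controls the first step that may leave the geometric phase: [a k.+1] is still known exactly, so
    [a k.+2] is bounded below by bounding both arguments of the minimum. It starts the inductions of
    the two other regimes. *)
Let ge_step_a (t : R) k : q ^+ k <= Bn -> 0 <= t -> t <= q ^+ k.+1 / (2 * Rp) ->
  (2 * Rp * t) ^+ 2 <= N * (N + sigma * A k.+1) -> t <= a k.+2.
Proof.
case: k => [|k] qB t0 tq tA.
  suff -> : a 2 = q ^+ 1 / (2 * Rp) by [].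
  by rewrite step_a2 step_a1 expr1 /q; field; rewrite !gt_eqF.
have [_ ak] := geometric_phase qB.
by rewrite step_aSSS qE ak// mulrA -exprS le_min tq sqrt_ge.
Qed.

Let ceil_log_nat (X : R) : 1 < X -> exists m : nat,
  [/\ Num.ceil (ln X / (ln N - ln (N - 1))) = m.+1%:Z, q ^+ m < X & X <= q ^+ m.+1].
Proof.
move=> X1; have X0 : 0 < X by rewrite (lt_trans _ X1).
have : 0 < Num.ceil (ln X / (ln N - ln (N - 1))).
  by rewrite ceil_gt0 lnq divr_gt0// ln_gt0.
case E : (Num.ceil _) => [[|m]|m]// _; exists m; split=> //.
  by rewrite ltNge -ceil_log_le// E lez_nat ltnn.
by rewrite -ceil_log_le// E.
Qed.

(** An index [k.+1] up to [k0] has [q ^+ k < Bn], so the closed form of the geometric phase applies,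
    with equality. *)
Lemma step_A_ge_geometric k : (0 < k)%N -> (k%:Z <= k0)%R ->
  (N - 1) / (2 * Rp) * (1 + 1 / (N - 1)) ^+ k <= A k.
Proof.
have X0 : 0 < Bn by have := NBn; have := N0; lra.
case: k => // k _ kk0; rewrite qE (geometric_phase _).1// ltW//.
by rewrite ltNge -ceil_log_le// -/k0 -ltNge (lt_le_trans _ kk0)// ltz_nat.
Qed.

(** Simultaneous induction: a quadratic bound on [A] forces a linear bound on the next step through
    the square root, and adding that step restores the quadratic bound. *)
Lemma step_A_ge_quadratic k : (k0 <= k%:Z)%R ->
  (N - 1) ^+ 2 * sigma / ((4 * Rp) ^+ 2 * N) * (k%:R - k0%:~R + N - 1) ^+ 2 <= A k.
Proof.
have B1 : 1 < Bn by have := NBn; have := N2; lra.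
have [m [k0E qB Bq]] := ceil_log_nat B1.
rewrite /k0 k0E lez_nat => /subnKC <-; set i := (k - m.+1)%N.
have -> : (m.+1 + i)%:R - (m.+1%:Z)%:~R + N - 1 = i%:R + N - 1 :> R.
  by rewrite natrD -pmulrn; lra.
rewrite addSn.
(* The slope [D] satisfies [(2 * Rp * D) ^+ 2 = N * sigma * C], matching the square root, and
   [(N - 1) * D = 2 * N * C], matching the increment of the square. *)
set C := _ / _; pose D := sigma * (N - 1) / (8 * Rp ^+ 2).
have C0 : 0 <= C.
  by rewrite divr_ge0 ?mulr_ge0 ?sqr_ge0// ltW.
have D0 : 0 <= D.
  by rewrite divr_ge0 ?mulr_ge0 ?sqr_ge0// ltW.
have CD : (N - 1) * D = 2 * N * C.
  by rewrite /C /D; field; rewrite !gt_eqF.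
have sqrtC (t : R) k' : C * t ^+ 2 <= A k' -> (2 * Rp * (D * t)) ^+ 2 <= N * (N + sigma * A k').
  move=> CA; have := ler_wpM2l (mulr_ge0 (ltW N0) sigma0) CA.
  have -> : N * sigma * (C * t ^+ 2) = (2 * Rp * (D * t)) ^+ 2.
    by rewrite /C /D; field; rewrite !gt_eqF.
  move/le_trans; apply; rewrite mulrDr mulrA lerDr.
  by rewrite mulr_ge0// ltW.
have Am : A m.+1 = (N - 1) / (2 * Rp) * q ^+ m.+1.
  by have [] := geometric_phase (ltW qB).
(* Both base cases replace the geometric power by its lower bound [2 * c]. *)
have q2c : 2 * c <= q ^+ m.+1 by have := cBn; lra.
suff [] : C * (i%:R + N - 1) ^+ 2 <= A (m + i).+1 /\ D * (i%:R + N - 1) <= a (m + i).+2 by [].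
elim: i => [|i [IHA IHa]]; rewrite ?addn0 ?addnS.
  rewrite add0r.
  have CA : C * (N - 1) ^+ 2 <= A m.+1.
    rewrite Am; apply: le_trans (_ : (N - 1) / (2 * Rp) * (2 * c) <= _); last first.
      by rewrite ler_wpM2l// divr_ge0// ltW.
    have -> : (N - 1) / (2 * Rp) * (2 * c) = C * (2 * N) ^+ 2.
      by rewrite /c /C; field; rewrite !gt_eqF.
    by rewrite ler_wpM2l// ler_sqr ?nnegrE//; have := N2; lra.
  split=> //; apply: ge_step_a (ltW qB) _ _ _; [|move=> {CA}|exact: sqrtC].
    by rewrite mulr_ge0// ltW.
  apply: le_trans (_ : 2 * c / (2 * Rp) <= _); last first.
    by rewrite ler_pM2r// invr_gt0.
  have -> : 2 * c / (2 * Rp) = D * (2 * N).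
    by rewrite /c /D; field; rewrite !gt_eqF.
  by rewrite ler_wpM2l//; have := N2; lra.
have i0 : 0 <= i%:R :> R by exact: ler0n.
rewrite -natr1; set M := i%:R + N - 1 in IHA IHa *.
have -> : i%:R + 1 + N - 1 = M + 1 by rewrite /M; lra.
have MN : N - 1 <= M by rewrite /M; lra.
have CA : C * (M + 1) ^+ 2 <= A (m + i).+2.
  rewrite step_AS; suff : C * (2 * M + 1) <= D * M by rewrite !expr2 in IHA *; lra.
  rewrite -(ler_pM2l N1) [X in _ <= X]mulrA CD.
  have M0 : 0 <= M by have := N1; lra.
  have := ler_wpM2l C0 MN; have := mulr_ge0 C0 M0; lra.
split=> //; rewrite step_aSSS qE le_min; apply/andP; split.
  apply: le_trans (ler_wpM2l (ltW q0) IHa); rewrite mulrCA ler_wpM2l//.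
  by rewrite /q mulrAC ler_pdivlMr//; lra.
by apply: sqrt_ge; [rewrite mulr_ge0//; have := N1; lra|exact: sqrtC].
Qed.

(** From [K0] on every step is at least [N / (2 * Rp)]: the square root is always that large, and
    the other argument multiplies the previous step by [q > 1]. *)
Lemma step_A_ge_linear k : (K0 <= k%:Z)%R ->
  N * (k%:R - K0%:~R + N - 1) / (2 * Rp) <= A k.
Proof.
have B1 : 1 < N by have := N2; lra.
have [m [k0E qN Nq]] := ceil_log_nat B1.
rewrite /K0 k0E lez_nat => /subnKC <-; set i := (k - m.+1)%N.
have -> : (m.+1 + i)%:R - (m.+1%:Z)%:~R + N - 1 = i%:R + N - 1 :> R.
  by rewrite natrD -pmulrn; lra.
rewrite addSn.
have qB : q ^+ m <= Bn by have := NBn; lra.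
have Am : A m.+1 = (N - 1) / (2 * Rp) * q ^+ m.+1 by have [] := geometric_phase qB.
have sqrtN k' : (2 * Rp * (N / (2 * Rp))) ^+ 2 <= N * (N + sigma * A k').
  have -> : 2 * Rp * (N / (2 * Rp)) = N by field; rewrite gt_eqF.
  by rewrite expr2 ler_pM2l// lerDl mulr_ge0// step_A_ge0.
have NR : 0 <= N / (2 * Rp) by rewrite divr_ge0// ltW.
suff [] : N * (i%:R + N - 1) / (2 * Rp) <= A (m + i).+1 /\ N / (2 * Rp) <= a (m + i).+2 by [].
elim: i => [|i [IHA IHa]]; rewrite ?addn0 ?addnS.
  split; last by apply: ge_step_a => //; rewrite ler_pM2r// invr_gt0.
  rewrite Am add0r.
  have -> : N * (N - 1) / (2 * Rp) = (N - 1) / (2 * Rp) * N by ring.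
  by rewrite ler_wpM2l// divr_ge0// ltW.
split.
  rewrite step_AS; apply: le_trans (lerD IHA IHa).
  rewrite -mulrDl ler_pM2r ?invr_gt0// -natr1; lra.
rewrite step_aSSS qE le_min sqrt_ge// andbT.
by apply: le_trans IHa _; rewrite ler_peMl ?(ltW q1)// ltW// step_a_gt0.
Qed.

End Steps.

(** * Real-valued estimate functions, their convexity and separability *)

Section RealEstimates.
Variables (R : realType) (n d : nat) (sigma Rp : R) (b : 'I_n -> 'rV[R]_d)
  (gs : 'I_n -> R -> \bar R) (l : 'rV[R]_d -> \bar R)
  (x0 : 'rV[R]_d) (y0 : 'rV[R]_n).
Hypotheses (n2 : (2 <= n)%N) (Rp0 : 0 < Rp) (sigma0 : 0 <= sigma).
Hypotheses (gsP : forall i, proper_fun (gs i) /\ convex_fun1 (gs i))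
  (lP : proper_fun l) (lC : strongly_convex sigma l).

Local Notation a := (step_a n sigma Rp).
Local Notation A := (step_A n sigma Rp).
Local Notation N := (n%:R : R).

Let N0 : 0 < N. Proof. by rewrite ltr0n ltnW. Qed.
Let at10 : 0 < at1 Rp. Proof. by rewrite /at1 divr_gt0// mulr_gt0. Qed.

(** Coordinatewise finiteness lets single coordinates be exchanged between two points without
    leaving the domain. *)
Definition dual_dom (w : 'rV[R]_n) := forall i, gs i (w ord0 i) \is a fin_num.
Definition primal_dom (w : 'rV[R]_d) := l w \is a fin_num.
Definition gval i (t : R) := fine (gs i t).
Definition gstar_val (w : 'rV[R]_n) := N^-1 * \sum_(i < n) gval i (w ord0 i).
Definition lval (w : 'rV[R]_d) := fine (l w).

Lemma gsE w i : dual_dom w -> gs i (w ord0 i) = (gval i (w ord0 i))%:E.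
Proof. by move=> Dw; rewrite /gval fineK. Qed.

Lemma lE w : primal_dom w -> l w = (lval w)%:E.
Proof. by move=> Dw; rewrite /lval fineK. Qed.

Lemma gs_ninfty i t : gs i t != -oo%E. Proof. exact: (gsP i).1.1. Qed.

Lemma gstar_fin w : dual_dom w -> gstar gs w = (gstar_val w)%:E.
Proof.
move=> Dw; rewrite /gstar /gstar_val EFinM -sumEFin.
by congr (_ * _)%E; apply: eq_bigr => i _; rewrite gsE.
Qed.

Lemma gstar_infty w : ~ dual_dom w -> gstar gs w = +oo%E.
Proof.
move=> Dw; rewrite /gstar; suff -> : (\sum_(i < n) gs i (w ord0 i))%E = +oo%E.
  by rewrite mulry gtr0_sg ?invr_gt0// mul1e.
apply/eqP; rewrite esum_eqy; last by move=> i _; exact: gs_ninfty.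
apply: contrapT => /negP; rewrite negb_exists => /forallP Dw'; apply: Dw => i.
have := Dw' i; rewrite /= => gi; rewrite fin_numE gs_ninfty /=; exact: gi.
Qed.

Lemma dom_gstar w : w \in dom (gstar gs) <-> dual_dom w.
Proof.
rewrite inE /dom /=; split=> [gw|Dw]; last by rewrite gstar_fin// ltry.
by apply: contrapT => /gstar_infty gE; rewrite gE ltxx in gw.
Qed.

Lemma dom_l w : w \in dom l <-> primal_dom w.
Proof.
by rewrite inE /dom /primal_dom /=; rewrite fin_numE lP.1 /= ltey.
Qed.

Lemma dual_dom_convex : convex_on dual_dom.
Proof.
move=> x y al al01 Dx Dy i; rewrite !mxE fin_numE gs_ninfty /= -ltey.
apply: le_lt_trans ((gsP i).2 _ _ _ al01) _.
by rewrite !gsE// -!EFinM -EFinD ltry.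
Qed.

Lemma primal_dom_convex : convex_on primal_dom.
Proof.
move=> x y al al01 Dx Dy; rewrite /primal_dom fin_numE lP.1 /= -ltey.
apply: le_lt_trans (lC _ _ al01) _.
by rewrite !lE// -!EFinM; exact: ltry.
Qed.

Lemma gval_convex i : sconvex_on dual_dom 0 (fun w => gval i (w ord0 i)).
Proof.
move=> x y al al01 Dx Dy; rewrite !mul0r subr0.
have := (gsP i).2 (x ord0 i) (y ord0 i) _ al01.
have := gsE i (dual_dom_convex al01 Dx Dy); rewrite !mxE => ->.
by rewrite !gsE// -!EFinM -EFinD lee_fin.
Qed.

Lemma gstar_val_convex : sconvex_on dual_dom 0 gstar_val.
Proof.
move=> x y al al01 Dx Dy; rewrite !mul0r subr0.
rewrite /gstar_val ![_ * (N^-1 * _)]mulrCA -mulrDr ler_pM2l ?invr_gt0//.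
rewrite !mulr_sumr -big_split /=; apply: ler_sum => i _.
by have := gval_convex i al01 Dx Dy; rewrite !mul0r subr0.
Qed.

Lemma lval_convex : sconvex_on primal_dom sigma lval.
Proof.
move=> x y al al01 Dx Dy.
have := lC x y al01; rewrite !lE -?EFinM ?lee_fin//.
exact: primal_dom_convex.
Qed.

Section Functions.
Variables (u : 'rV[R]_d) (v : 'rV[R]_n) (j : nat -> 'I_n)
  (x : nat -> 'rV[R]_d) (y : nat -> 'rV[R]_n) (z : nat -> 'rV[R]_d).

Definition psi_incr k (w : 'rV[R]_n) : R :=
  - dotv (b (j k)) (xbar n sigma Rp x k.-1) * (w ord0 (j k) - v ord0 (j k))
  + gval (j k) (w ord0 (j k)).

Definition phi_incr k (w : 'rV[R]_d) : R :=
  dotv (w - u) (z k.-1 + (y k ord0 (j k) - y k.-1 ord0 (j k)) *: b (j k)) + lval w.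

(* Real-valued [psi] and [phi], with index shifted by one: [psi_val k] is
   [psi k.+1] on its domain. *)
Fixpoint psi_val k w : R :=
  if k is k'.+1 then psi_val k' w + a k.+1 * psi_incr k.+1 w
  else N * (sqnorm (w - y0) / 2
            + at1 Rp * (dotv (- Bmul b x0) (w - v) + gstar_val w)).

Fixpoint phi_val k w : R :=
  if k is k'.+1 then phi_val k' w + a k.+1 * phi_incr k.+1 w
  else N * (sqnorm (w - x0) / 2 + at1 Rp * (dotv (w - u) (z 1) + lval w)).

Local Notation psi' := (psi sigma Rp b gs x0 y0 v j x).
Local Notation phi' := (phi sigma Rp b l x0 u j y z).

Lemma psiE k w : dual_dom w -> psi' k.+1 w = (psi_val k w)%:E.
Proof.
move=> Dw; elim: k => [|k IH].
  by rewrite /= /psi_t1 gstar_fin.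
have -> : psi' k.+2 w = (psi' k.+1 w + (a k.+2)%:E *
  ((- dotv (b (j k.+2)) (xbar n sigma Rp x k.+1)
      * (w ord0 (j k.+2) - v ord0 (j k.+2)))%R%:E + gs (j k.+2) (w ord0 (j k.+2))))%E.
  by [].
by rewrite IH gsE.
Qed.

Lemma psi_infty k w : ~ dual_dom w -> psi' k.+1 w = +oo%E.
Proof.
move=> Dw; elim: k => [|k IH].
  rewrite /= /psi_t1 gstar_infty// addey// mulry gtr0_sg// mul1e addey//.
  by rewrite mulry gtr0_sg// mul1e.
have -> : psi' k.+2 w = (psi' k.+1 w + (a k.+2)%:E *
  ((- dotv (b (j k.+2)) (xbar n sigma Rp x k.+1)
      * (w ord0 (j k.+2) - v ord0 (j k.+2)))%R%:E + gs (j k.+2) (w ord0 (j k.+2))))%E.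
  by [].
rewrite IH addye//; have := gs_ninfty (j k.+2) (w ord0 (j k.+2)).
case: (gs _ _) => [r||] //= _; rewrite addey//.
by rewrite mulry gtr0_sg ?mul1e// step_a_gt0.
Qed.

Lemma phiE k w : primal_dom w -> phi' k.+1 w = (phi_val k w)%:E.
Proof.
move=> Dw; elim: k => [|k IH]; first by rewrite /= /phi_t1 lE.
have -> : phi' k.+2 w = (phi' k.+1 w + (a k.+2)%:E *
  ((dotv (w - u) (z k.+1 + (y k.+2 ord0 (j k.+2) - y k.+1 ord0 (j k.+2)) *: b (j k.+2)))%R%:E
   + l w))%E.
  by [].
by rewrite IH lE.
Qed.

Lemma phi_infty k w : ~ primal_dom w -> phi' k.+1 w = +oo%E.
Proof.
move=> Dw; have lw : l w = +oo%E.
  apply/eqP; apply: contrapT => /negP lw; apply: Dw.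
  by rewrite /primal_dom fin_numE lP.1.
elim: k => [|k IH].
  rewrite /= /phi_t1 lw addey// mulry gtr0_sg// mul1e addey//.
  by rewrite mulry gtr0_sg// mul1e.
have -> : phi' k.+2 w = (phi' k.+1 w + (a k.+2)%:E *
  ((dotv (w - u) (z k.+1 + (y k.+2 ord0 (j k.+2) - y k.+1 ord0 (j k.+2)) *: b (j k.+2)))%R%:E
   + l w))%E.
  by [].
by rewrite IH lw addye// addey// mulry gtr0_sg ?mul1e// step_a_gt0.
Qed.

(** Off the domain the estimate function is infinite while it is finite at [y0], so an argmin lies
    in the domain. *)
Lemma psi_minimizer k p : dual_dom y0 -> is_argmin (psi' k.+1) p ->
  minimizer_on dual_dom (psi_val k) p.
Proof.
move=> D0 pm; have Dp : dual_dom p.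
  apply: contrapT => /(psi_infty k) pE.
  by have := pm y0; rewrite pE psiE// leye_eq.
by split=> // w Dw; have := pm w; rewrite !psiE// lee_fin.
Qed.

Lemma phi_minimizer k p : primal_dom x0 -> is_argmin (phi' k.+1) p ->
  minimizer_on primal_dom (phi_val k) p.
Proof.
move=> D0 pm; have Dp : primal_dom p.
  apply: contrapT => /(phi_infty k) pE.
  by have := pm x0; rewrite pE phiE// leye_eq.
by split=> // w Dw; have := pm w; rewrite !phiE// lee_fin.
Qed.

Lemma psi_val_convex k : sconvex_on dual_dom N (psi_val k).
Proof.
elim: k => [|k IH].
  have -> : N = N * (1 + at1 Rp * (0 + 0)) by ring.
  apply: sconvexZ; first exact: ltW.
  apply: sconvexD; first exact: sconvex_sqnorm.
  apply: sconvexZ; first exact: ltW.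
  apply: sconvexD; last exact: gstar_val_convex.
  apply: (sconvex_ext _ (@sconvex_dotvr _ _ _ v (- Bmul b x0))) => w.
  exact: dotvC.
have -> : N = N + a k.+2 * (0 + 0) by ring.
apply: sconvexD; first exact: IH.
apply: sconvexZ; first by rewrite ltW// step_a_gt0.
apply: sconvexD; last exact: gval_convex.
by move=> p q al _ _ _; rewrite !mxE; lra.
Qed.

(** The quadratic term contributes [N], and each step adds [sigma] times its step size through
    [l]. *)
Lemma phi_val_convex k : sconvex_on primal_dom (N + sigma * A k.+1) (phi_val k).
Proof.
elim: k => [|k IH].
  have -> : N + sigma * A 1 = N * (1 + at1 Rp * (0 + sigma)).
    by rewrite step_AS step_a1 /step_A /at1 /=; field; rewrite gt_eqF.
  apply: sconvexZ; first exact: ltW.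
  apply: sconvexD; first exact: sconvex_sqnorm.
  apply: sconvexZ; first exact: ltW.
  by apply: sconvexD lval_convex; exact: sconvex_dotvr.
have -> : N + sigma * A k.+2 = (N + sigma * A k.+1) + a k.+2 * (0 + sigma).
  by rewrite step_AS; ring.
apply: sconvexD; first exact: IH.
apply: sconvexZ; first by rewrite ltW// step_a_gt0.
by apply: sconvexD lval_convex; exact: sconvex_dotvr.
Qed.

Lemma NsA_gt0 k : 0 < N + sigma * A k.
Proof. by rewrite ltr_pwDl// mulr_ge0// step_A_ge0. Qed.

Lemma psi_val_growth k p w : minimizer_on dual_dom (psi_val k) p -> dual_dom w ->
  psi_val k p + N / 2 * sqnorm (w - p) <= psi_val k w.
Proof. exact: sconvex_growth dual_dom_convex (psi_val_convex k) (ltW N0). Qed.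

Lemma phi_val_growth k p w : minimizer_on primal_dom (phi_val k) p -> primal_dom w ->
  phi_val k p + (N + sigma * A k.+1) / 2 * sqnorm (w - p) <= phi_val k w.
Proof.
exact: sconvex_growth primal_dom_convex (phi_val_convex k) (ltW (NsA_gt0 _)).
Qed.

Definition swap_coord (i0 : 'I_n) (p q : 'rV[R]_n) : 'rV[R]_n :=
  \row_i (if i == i0 then q ord0 i else p ord0 i).

Lemma sum_swap_coord i0 (p q : 'rV[R]_n) (F : 'I_n -> R -> R) :
  \sum_i F i (swap_coord i0 p q ord0 i) + \sum_i F i (swap_coord i0 q p ord0 i) =
  \sum_i F i (p ord0 i) + \sum_i F i (q ord0 i).
Proof.
rewrite -!big_split; apply: eq_bigr => i _; rewrite !mxE /=.
by case: ifP => // _; rewrite addrC.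
Qed.

(** [psi_val k] is a sum of functions of single coordinates plus a constant, and the swapped pair
    has the same two values in each coordinate. *)
Lemma psi_val_swap k i0 p q :
  psi_val k (swap_coord i0 p q) + psi_val k (swap_coord i0 q p) =
  psi_val k p + psi_val k q.
Proof.
elim: k => [|k IH] /=.
  have E1 := sum_swap_coord i0 p q (fun i t => (t - y0 ord0 i) * (t - y0 ord0 i)).
  have E2 := sum_swap_coord i0 p q (fun i t => (- Bmul b x0) ord0 i * (t - v ord0 i)).
  have E3 := sum_swap_coord i0 p q (fun i t => gval i t).
  have S w : sqnorm (w - y0) = \sum_i (w ord0 i - y0 ord0 i) * (w ord0 i - y0 ord0 i).
    by apply: eq_bigr => i _; rewrite !mxE.
  have T w : dotv (- Bmul b x0) (w - v) =
      \sum_i (- Bmul b x0) ord0 i * (w ord0 i - v ord0 i).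
    by apply: eq_bigr => i _; rewrite !mxE.
  rewrite !S !T /gstar_val -!mulrDr.
  have /= := congr1 (fun t => N * (t / 2)) E1.
  have /= := congr1 (fun t => N * (at1 Rp * t)) E2.
  have /= := congr1 (fun t => N * (at1 Rp * (N^-1 * t))) E3.
  lra.
suff : psi_incr k.+2 (swap_coord i0 p q) + psi_incr k.+2 (swap_coord i0 q p)
   = psi_incr k.+2 p + psi_incr k.+2 q.
  move=> /(congr1 (fun t => a k.+2 * t)); lra.
by rewrite /psi_incr !mxE; case: ifP => // _; rewrite addrC.
Qed.

(* The step at [k.+2] only touches coordinate [j k.+2] of a separable function,
   so swapping that coordinate between the two minimizers changes nothing in total. *)
Lemma psi_minimizer_coord k p q : minimizer_on dual_dom (psi_val k) p ->
  minimizer_on dual_dom (psi_val k.+1) q -> q = swap_coord (j k.+2) p q.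
Proof.
move=> pm qm; set i0 := j k.+2.
have D1 : dual_dom (swap_coord i0 p q).
  by move=> i; rewrite mxE; case: ifP => _; [exact: qm.1|exact: pm.1].
have D2 : dual_dom (swap_coord i0 q p).
  by move=> i; rewrite mxE; case: ifP => _; [exact: pm.1|exact: qm.1].
have := psi_val_swap k i0 p q; have := pm.2 _ D2; have := psi_val_growth qm D1.
(* The swapped point has the coordinate [i0] of [q], so the last increment cancels and the
   minimality of [p] can be used. *)
rewrite /= (_ : psi_incr _ (swap_coord _ _ _) = psi_incr k.+2 q); last first.
  by rewrite /psi_incr !mxE eqxx.
move=> h1 h2 h3; apply/esym/subr0_eq/sqnorm_eq0.
rewrite -(pmulr_rle0 _ (_ : 0 < N / 2)) ?divr_gt0//; lra.
Qed.

End Functions.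

(** The point [v] enters only through additive constants, so the minimizers are independent of
    it. *)
Lemma psi_val_shift v v' j x k p q :
  psi_val v j x k p - psi_val v j x k q = psi_val v' j x k p - psi_val v' j x k q.
Proof.
by elim: k => [|k IH] /=; rewrite ?/psi_incr ?dotvE; lra.
Qed.

Lemma phi_val_shift u u' j y z k p q :
  phi_val u j y z k p - phi_val u j y z k q = phi_val u' j y z k p - phi_val u' j y z k q.
Proof.
by elim: k => [|k IH] /=; rewrite ?/phi_incr ?dotvE; lra.
Qed.

(** Records which part of the past the function depends on; needed to show that the iterates are
    adapted. *)
Lemma psi_val_eq v j j' x x' k w : (forall i, (2 <= i <= k.+1)%N -> j i = j' i) ->
  (forall i, (i <= k)%N -> x i = x' i) -> psi_val v j x k w = psi_val v j' x' k w.
Proof.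
elim: k => [//|k IH] jj xx /=; rewrite IH; last 2 first.
- by move=> i /andP[i2 ik]; apply: jj; rewrite i2 ltnW.
- by move=> i ik; apply: xx; rewrite ltnW.
by rewrite /psi_incr jj ?ltnSn// /xbar /= !xx.
Qed.

Lemma phi_val_eq u j j' y y' z z' k w : (forall i, (2 <= i <= k.+1)%N -> j i = j' i) ->
  (forall i, (0 < i <= k.+1)%N -> y i = y' i) -> z 1 = z' 1 ->
  (forall i, (0 < i <= k)%N -> z i = z' i) ->
  phi_val u j y z k w = phi_val u j' y' z' k w.
Proof.
move=> + + z1; elim: k => [|k IH] jj yy zz /=; first by rewrite z1.
rewrite IH; last 3 first.
- by move=> i /andP[i2 ik]; apply: jj; rewrite i2 ltnW.
- by move=> i /andP[i0 ik]; apply: yy; rewrite i0 ltnW.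
- by move=> i /andP[i0 ik]; apply: zz; rewrite i0 ltnW.
by rewrite /phi_incr jj ?ltnSn// !yy ?leqnn ?leqnSn//= !zz ?leqnn.
Qed.

End RealEstimates.

(** * The bilinear coupling term and changes of one coordinate *)

Section Coupling.
Variables (R : realType) (n d : nat) (b : 'I_n -> 'rV[R]_d).
Local Notation N := (n%:R : R).

Definition coupling (x : 'rV[R]_d) (y : 'rV[R]_n) := dotv (Bmul b x) y.

Lemma couplingE x y : coupling x y = N^-1 * \sum_(i < n) dotv (b i) x * y ord0 i.
Proof.
rewrite /coupling /dotv mulr_sumr; apply: eq_bigr => i _.
by rewrite mxE mulrCA mulrA mulrC mulrA.
Qed.

Lemma dotv_BTmul x y : dotv x (BTmul b y) = coupling x y.
Proof.
rewrite couplingE mulr_sumr /BTmul.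
rewrite (big_morph (dotv x) (fun p q => dotvDr p q x) (dotv0r x)).
by apply: eq_bigr => i _; rewrite dotvZr dotvC; ring.
Qed.

Lemma couplingDl x x' y : coupling (x + x') y = coupling x y + coupling x' y.
Proof. by rewrite -!dotv_BTmul dotvDl. Qed.

Lemma couplingZl c x y : coupling (c *: x) y = c * coupling x y.
Proof. by rewrite -!dotv_BTmul dotvZl. Qed.

Lemma couplingNl x y : coupling (- x) y = - coupling x y.
Proof. by rewrite -!dotv_BTmul dotvNl. Qed.

Lemma couplingDr x y y' : coupling x (y + y') = coupling x y + coupling x y'.
Proof. exact: dotvDr. Qed.

Lemma couplingZr c x y : coupling x (c *: y) = c * coupling x y.
Proof. exact: dotvZr. Qed.

Lemma couplingNr x y : coupling x (- y) = - coupling x y.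
Proof. exact: dotvNr. Qed.

Definition coupling_linear :=
  (couplingDl, couplingDr, couplingZl, couplingZr, couplingNl, couplingNr).

(** The rows of the matrix are [b i] divided by [N], so its squared Frobenius norm is at most
    [r ^+ 2 / N]. *)
Lemma coupling_sqr (r : R) x y : (0 < n)%N -> (forall i, sqnorm (b i) <= r ^+ 2) ->
  N * coupling x y ^+ 2 <= r ^+ 2 * sqnorm x * sqnorm y.
Proof.
move=> n0 br; have N0 : 0 < N by rewrite ltr0n.
have bx i : dotv (b i) x ^+ 2 <= r ^+ 2 * sqnorm x.
  by apply: le_trans (cauchy_schwarz _ _) _; rewrite ler_wpM2r ?sqnorm_ge0.
have Bx : sqnorm (Bmul b x) <= r ^+ 2 * sqnorm x / N.
  have -> : r ^+ 2 * sqnorm x / N = \sum_(i < n) r ^+ 2 * sqnorm x / N ^+ 2.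
    by rewrite sumr_const card_ord -mulr_natr; field; rewrite gt_eqF.
  apply: ler_sum => i _; rewrite mxE -expr2 expr_div_n.
  by rewrite ler_pM2r ?invr_gt0 ?exprn_gt0.
have := cauchy_schwarz (Bmul b x) y; rewrite -/(coupling x y) => cs.
have := le_trans cs (ler_wpM2r (sqnorm_ge0 y) Bx).
rewrite -(ler_pM2l N0) => /le_trans; apply.
by rewrite le_eqVlt; apply/orP; left; apply/eqP; field; rewrite gt_eqF.
Qed.

(** The hypothesis [q = swap_coord i0 p q] says that [p] and [q] differ at most in coordinate
    [i0]. *)
Lemma sum_change_coord (V : zmodType) (F : 'I_n -> R -> V) i0 (p q : 'rV[R]_n) :
  q = swap_coord i0 p q ->
  \sum_i F i (q ord0 i) = \sum_i F i (p ord0 i) + (F i0 (q ord0 i0) - F i0 (p ord0 i0)).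
Proof.
move=> qE; rewrite (bigD1 i0)//= [in RHS](bigD1 i0)//= [RHS]addrC addrA subrK.
congr (_ + _).
by apply: eq_bigr => i ii0; rewrite qE mxE (negbTE ii0).
Qed.

Lemma BTmul_change_coord i0 (p q : 'rV[R]_n) : q = swap_coord i0 p q ->
  BTmul b q = BTmul b p + ((q ord0 i0 - p ord0 i0) / N) *: b i0.
Proof.
move=> /(sum_change_coord (fun i t => (t / N) *: b i)) E.
by rewrite /BTmul E mulrBl scalerBl.
Qed.

Lemma coupling_change_coord i0 x (p q : 'rV[R]_n) : q = swap_coord i0 p q ->
  coupling x q = coupling x p + N^-1 * (q ord0 i0 - p ord0 i0) * dotv (b i0) x.
Proof.
move=> /BTmul_change_coord E; rewrite -!dotv_BTmul E dotvDr dotvZr (dotvC x (b i0)).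
by ring.
Qed.

Lemma sqnorm_change_coord i0 (p q : 'rV[R]_n) : q = swap_coord i0 p q ->
  sqnorm (q - p) = (q ord0 i0 - p ord0 i0) ^+ 2.
Proof.
move=> qE; rewrite /sqnorm /dotv (bigD1 i0)//= !mxE -expr2 big1 ?addr0// => i ii0.
by rewrite !mxE {1 2}qE !mxE (negbTE ii0) subrr mulr0.
Qed.

End Coupling.

(** * Estimates along a single sample path *)

Section Pathwise.
Variables (R : realType) (n d : nat) (sigma Rp : R) (b : 'I_n -> 'rV[R]_d)
  (gs : 'I_n -> R -> \bar R) (l : 'rV[R]_d -> \bar R)
  (x0 : 'rV[R]_d) (y0 : 'rV[R]_n).
Hypotheses (n2 : (2 <= n)%N) (Rp0 : 0 < Rp) (sigma0 : 0 <= sigma).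
Hypotheses (gsP : forall i, proper_fun (gs i) /\ convex_fun1 (gs i))
  (lP : proper_fun l) (lC : strongly_convex sigma l).
Hypothesis bR : forall i, sqnorm (b i) <= Rp ^+ 2.

Local Notation a := (step_a n sigma Rp).
Local Notation A := (step_A n sigma Rp).
Local Notation N := (n%:R : R).
Local Notation xb := (xbar n sigma Rp).

Variables (u : 'rV[R]_d) (v : 'rV[R]_n) (j : nat -> 'I_n)
  (x : nat -> 'rV[R]_d) (y : nat -> 'rV[R]_n) (z : nat -> 'rV[R]_d) (K : nat).
Hypotheses (Du : primal_dom l u) (Dv : dual_dom gs v).

Local Notation psi' := (psi_val sigma Rp b gs x0 y0 v j x).
Local Notation phi' := (phi_val sigma Rp b l x0 u j y z).

Definition real_run :=
  [/\ x 0 = x0, z 1 = BTmul b (y 1),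
      forall k, (k.+2 <= K)%N -> z k.+2 =
        z k.+1 + ((y k.+2 ord0 (j k.+2) - y k.+1 ord0 (j k.+2)) / N) *: b (j k.+2) &
      forall k, (k < K)%N -> minimizer_on (dual_dom gs) (psi' k) (y k.+1) /\
                         minimizer_on (primal_dom l) (phi' k) (x k.+1)].

Hypothesis run : real_run.

Let N2 : 2 <= N. Proof. by rewrite (ler_nat _ 2). Qed.
Let N0 : 0 < N. Proof. by rewrite ltr0n ltnW. Qed.

Lemma run_change_coord k : (k.+2 <= K)%N ->
  y k.+2 = swap_coord (j k.+2) (y k.+1) (y k.+2).
Proof.
case: run => _ _ _ mk kK.
have h1 := (mk _ (ltnW kK)).1.
have h2 := (mk _ kK).1.
exact: (psi_minimizer_coord n2 Rp0 sigma0 gsP h1 h2).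
Qed.

(** Only coordinate [j k] of the dual iterate moves, so the incremental update of [z] tracks the
    full matrix product. *)
Lemma run_zE k : (k < K)%N -> z k.+1 = BTmul b (y k.+1).
Proof.
case: (run) => _ z1 zS _; elim: k => [//|k IH] kK.
by rewrite zS// IH ?(ltnW kK)// (BTmul_change_coord b (run_change_coord kK)).
Qed.

(** The increment of [psi] for index [t], minus its value at [v], taken at the previous iterate
    [y i.-1], which is determined before [j i] is drawn. *)
Definition index_term i (t : 'I_n) : R :=
  - dotv (b t) (xb x i.-1) * (y i.-1 ord0 t - v ord0 t)
  + gval gs t (y i.-1 ord0 t) - gval gs t (v ord0 t).

Definition noise k :=
  \sum_(2 <= i < k.+2) a i * (index_term i (j i) - N^-1 * \sum_t index_term i t).

Lemma index_term_mean i : N^-1 * \sum_t index_term i t =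
  - coupling b (xb x i.-1) (y i.-1) + coupling b (xb x i.-1) v
  + gstar_val gs (y i.-1) - gstar_val gs v.
Proof.
rewrite !couplingE /gstar_val -!mulrN -!mulrDr -!sumrN -!big_split /=; congr (_ * _).
by apply: eq_bigr => t _; rewrite /index_term; ring.
Qed.

(* Dual weights of the averaged iterate, before summation by parts. *)
Definition dual_weighted (f : nat -> R) k :=
  a 1 * f 1%N + \sum_(2 <= i < k.+2) a i * (N * f i - (N - 1) * f i.-1).

Lemma dual_weightedS f k : dual_weighted f k.+1 =
  dual_weighted f k + a k.+2 * (N * f k.+2 - (N - 1) * f k.+1).
Proof. by rewrite /dual_weighted big_nat_recr//= addrA. Qed.

(** Summation by parts; the weight of [f 1] cancels because [a 1 = (N - 1) * a 2]. *)
Lemma dual_weightedE f k : dual_weighted f k.+1 = N * a k.+2 * f k.+2 +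
  \sum_(2 <= i < k.+2) (N * a i - (N - 1) * a i.+1) * f i.
Proof.
elim: k => [|k IH]; rewrite dual_weightedS.
  by rewrite /dual_weighted big_geq// big_geq// step_a1E//; ring.
by rewrite IH [in RHS]big_nat_recr//=; ring.
Qed.

Definition primal_weighted (f : nat -> R) k := \sum_(1 <= i < k.+2) a i * f i.

(** Up to the terms in [gstar_val gs v] and [lval l u], a weighted sum of Lagrangian gaps in which
    primal and dual iterates carry different weights of equal total. *)
Definition gap_sum k :=
  primal_weighted (fun i => coupling b (x i) v + lval l (x i)) k
  - dual_weighted (fun i => coupling b u (y i)) k
  + dual_weighted (fun i => gstar_val gs (y i)) k.

Lemma psi_val_v k : psi' k v = N / 2 * sqnorm (v - y0) + a 1 * gstar_val gs v
  + \sum_(2 <= i < k.+2) a i * gval gs (j i) (v ord0 (j i)).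
Proof.
elim: k => [|k IH] /=.
  rewrite big_geq// subrr dotv0r step_a1 /at1; field; rewrite gt_eqF//.
by rewrite IH /psi_incr subrr mulr0 add0r [in RHS]big_nat_recr//= addrA.
Qed.

Lemma phi_val_u k : phi' k u = N / 2 * sqnorm (u - x0) + A k.+1 * lval l u.
Proof.
elim: k => [|k IH] /=.
  by rewrite subrr dotvC dotv0r step_AS step_a1 /step_A /at1 /=; field; rewrite gt_eqF.
by rewrite IH /phi_incr subrr dotvC dotv0r add0r [in RHS]step_AS; ring.
Qed.

(** Combines [sqr_le_half] with [step_a_sqr]: [4 * (a k.+1 * t * s) ^+ 2] is at most
    [(2 * Rp * a k.+1) ^+ 2 * (t ^+ 2 * p)]. *)
Lemma young_step k (s t p : R) : 0 <= p -> s ^+ 2 <= Rp ^+ 2 * p ->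
  `|a k.+1 * t * s| <= (N * t ^+ 2 + (N + sigma * A k) * p) / 4.
Proof.
move=> p0 sp; apply: sqr_le_half.
- by rewrite mulr_ge0 ?sqr_ge0// ltW.
- by rewrite mulr_ge0// ltW// NsA_gt0.
have a2 := step_a_sqr n2 Rp0 sigma0 k.
have -> : 4 * (a k.+1 * t * s) ^+ 2 = 4 * a k.+1 ^+ 2 * t ^+ 2 * s ^+ 2 by ring.
apply: le_trans (_ : 4 * a k.+1 ^+ 2 * t ^+ 2 * (Rp ^+ 2 * p) <= _).
  rewrite ler_wpM2l//.
  by apply: mulr_ge0 (mulr_ge0 _ (sqr_ge0 _)) (sqr_ge0 _).
have -> : 4 * a k.+1 ^+ 2 * t ^+ 2 * (Rp ^+ 2 * p) = (2 * Rp * a k.+1) ^+ 2 * (t ^+ 2 * p).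
  by ring.
have -> : N * t ^+ 2 * ((N + sigma * A k) * p) = (N * (N + sigma * A k)) * (t ^+ 2 * p).
  by ring.
by rewrite ler_wpM2r// mulr_ge0// sqr_ge0.
Qed.

Lemma dotv_b_sqr i (w : 'rV[R]_d) : dotv (b i) w ^+ 2 <= Rp ^+ 2 * sqnorm w.
Proof.
by apply: le_trans (cauchy_schwarz _ _) _; rewrite ler_wpM2r ?sqnorm_ge0.
Qed.

(* Half of the quadratic growth of [phi] pays for the coupling error of the
   current step; the other half is carried over to pay for the extrapolation at
   the next one. *)
Lemma estimate_lower_bound k : (k < K)%N ->
  gap_sum k - A k.+1 * gstar_val gs v - N / 2 * sqnorm (v - y0)
  + a k.+1 * coupling b (x k.+1 - x k) (y k.+1 - v)
  + (N + sigma * A k) / 4 * sqnorm (x k.+1 - x k) + noise k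
  <= psi' k (y k.+1) + phi' k (x k.+1) - psi' k v.
Proof.
case: (run) => x0E z1 zS mk; elim: k => [|k IH] kK.
  rewrite psi_val_v /gap_sum /primal_weighted /dual_weighted /noise big_nat1 !big_geq//=.
  rewrite z1 x0E step_AS (_ : A 0 = 0)// !dotvE !dotv_BTmul -!/(coupling _ _ _).
  rewrite -!/(coupling _ _ _) !coupling_linear.
  have -> : at1 Rp = a 1 / N by rewrite step_a1 /at1; field; rewrite !gt_eqF.
  have /= := sqnorm_ge0 (y 1 - y0); have /= := sqnorm_ge0 (x 1 - x0).
  set X := sqnorm (x 1 - x0); set Y := sqnorm (y 1 - y0) => X0 Y0.
  (* At the first step the linear and coupling terms agree exactly, and only squares are left
     over. *)
  rewrite -subr_ge0 [X in 0 <= X](_ : _ = N / 2 * Y + N / 4 * X); last first.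
    by rewrite /coupling; field; rewrite gt_eqF.
  by rewrite addr_ge0// mulr_ge0// divr_ge0// ltW.
have kK' := ltnW kK.
have [ym xm] := mk _ kK'; have [ym' xm'] := mk _ kK.
have yc := run_change_coord kK; have zE := run_zE kK'.
have F1 := psi_val_growth n2 Rp0 sigma0 gsP ym ym'.1.
have F2 := phi_val_growth n2 Rp0 sigma0 lP lC xm xm'.1.
rewrite (sqnorm_change_coord yc) in F1.
set i0 := j k.+2 in yc F1 *.
pose D := y k.+2 ord0 i0 - y k.+1 ord0 i0; rewrite -/D in F1.
have Y1 : `|a k.+2 * D * dotv (b i0) (x k.+2 - x k.+1)| <=
    (N * D ^+ 2 + (N + sigma * A k.+1) * sqnorm (x k.+2 - x k.+1)) / 4.
  by apply: young_step; [exact: sqnorm_ge0|exact: dotv_b_sqr].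
have Y2 : `|a k.+1 * D * dotv (b i0) (x k.+1 - x k)| <=
    (N * D ^+ 2 + (N + sigma * A k) * sqnorm (x k.+1 - x k)) / 4.
  by apply: young_step; [exact: sqnorm_ge0|exact: dotv_b_sqr].
(* A share [N^-1] of this error belongs to the coupling term carried to the next step, so only the
   fraction [1 - N^-1] has to be absorbed. *)
have {Y1}Y1 : - ((1 - N^-1) * (a k.+2 * D * dotv (b i0) (x k.+2 - x k.+1))) <=
    (N * D ^+ 2 + (N + sigma * A k.+1) * sqnorm (x k.+2 - x k.+1)) / 4.
  apply: le_trans Y1; apply: le_trans (ler_norm _) _.
  have Ni0 : 0 <= N^-1 by rewrite invr_ge0 ltW.
  have Ni1 : N^-1 <= 1 by rewrite invf_le1// ler1n ltnW.
  by rewrite normrN normrM ler_piMl// ger0_norm; lra.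
have {Y2}Y2 := le_trans (ler_norm _) Y2.
have := IH kK'; set P := sqnorm (x k.+2 - x k.+1) in F2 Y1 *.
set P' := sqnorm (x k.+1 - x k) in Y2 *.
rewrite /gap_sum !dual_weightedS /primal_weighted /noise.
rewrite [in X in _ -> X]big_nat_recr//= [\sum_(2 <= i < k.+3) _]big_nat_recr//=.
rewrite index_term_mean /index_term /psi_incr /phi_incr -/i0 zE /=.
rewrite [A k.+2]step_AS.
set pw := \sum_(1 <= i < k.+2) _; set dw1 := dual_weighted _ _.
set dw2 := dual_weighted _ _; set ns := \sum_(2 <= i < k.+2) _.
(* Writing everything in [E], [h] and [rho] removes the inverse of [N] and the ratio of step sizes,
   so the remaining goal is linear in its monomials. *)
pose E := N^-1 * D; have DE : D = N * E by rewrite /E mulrA divff ?mul1r ?gt_eqF.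
pose h := N^-1 * (gval gs i0 (y k.+2 ord0 i0) - gval gs i0 (y k.+1 ord0 i0)).
have gE : gstar_val gs (y k.+2) = gstar_val gs (y k.+1) + h.
  by rewrite /gstar_val (sum_change_coord (gval gs) yc) mulrDr.
have hE : gval gs i0 (y k.+2 ord0 i0) = gval gs i0 (y k.+1 ord0 i0) + N * h.
  by rewrite /h mulrA divff ?mul1r ?gt_eqF//; ring.
have yE : y k.+2 ord0 i0 = y k.+1 ord0 i0 + D by rewrite /D; ring.
pose rho := a k.+1 / a k.+2.
have aE : a k.+1 = a k.+2 * rho by rewrite /rho mulrCA divff ?mulr1 ?gt_eqF ?step_a_gt0.
have xbE : xb x k.+1 = x k.+1 + rho *: (x k.+1 - x k) by [].
rewrite gE hE !subrr yE xbE; move: IH F1 F2 Y1 Y2 => _.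
rewrite !coupling_linear !(coupling_change_coord b _ yc) -/D -/E.
rewrite !dotvE !dotv_BTmul (dotvC (x k.+2)) (dotvC u) aE.
have -> : (1 - N^-1) * (a k.+2 * D * (dotv (b i0) (x k.+2) - dotv (b i0) (x k.+1)))
  = (N - 1) * (a k.+2 * E * (dotv (b i0) (x k.+2) - dotv (b i0) (x k.+1))).
  by rewrite DE; field; rewrite gt_eqF.
rewrite DE; move: E h rho {DE gE hE aE xbE yE} => E h rho.
lra.
Qed.

(** Quadratic growth at [v] and [u] bounds the minimal values from above. The last coupling term
    costs at most [N / 4] of the [N / 2] available in front of [sqnorm (v - y k.+1)]. *)
Lemma pathwise_bound k : (k < K)%N ->
  gap_sum k - A k.+1 * gstar_val gs v - A k.+1 * lval l u
  + (N / 4 * sqnorm (v - y k.+1) + (N + sigma * A k.+1) / 2 * sqnorm (u - x k.+1))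
  + noise k <= N * (sqnorm (u - x0) + sqnorm (v - y0)) / 2.
Proof.
move=> kK; have [_ _ _ /(_ _ kK) [ym xm]] := run.
have F1 := psi_val_growth n2 Rp0 sigma0 gsP ym Dv.
have := phi_val_growth n2 Rp0 sigma0 lP lC xm Du; rewrite phi_val_u => F2.
have F3 := estimate_lower_bound kK.
have F4 : `|a k.+1 * coupling b (x k.+1 - x k) (y k.+1 - v)| <=
    ((N + sigma * A k) * sqnorm (x k.+1 - x k) + sqnorm (y k.+1 - v)) / 4.
  apply: sqr_le_half; rewrite ?sqnorm_ge0//.
    by rewrite mulr_ge0 ?sqnorm_ge0// ltW// NsA_gt0.
  have := coupling_sqr (x k.+1 - x k) (y k.+1 - v) (ltnW n2) bR.
  have := step_a_sqr n2 Rp0 sigma0 k.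
  set p := sqnorm _; set q := sqnorm _; set s := coupling _ _ _ => a2 cs.
  rewrite -(ler_pM2l N0).
  have -> : N * (4 * (a k.+1 * s) ^+ 2) = 4 * a k.+1 ^+ 2 * (N * s ^+ 2) by ring.
  apply: le_trans (ler_wpM2l _ cs) _; first by apply: mulr_ge0 (sqr_ge0 _).
  have -> : 4 * a k.+1 ^+ 2 * (Rp ^+ 2 * p * q) = (2 * Rp * a k.+1) ^+ 2 * (p * q) by ring.
  by rewrite !mulrA -mulrA -[X in _ <= X]mulrA ler_wpM2r// mulr_ge0 ?sqnorm_ge0.
have {F4}F4 : - (a k.+1 * coupling b (x k.+1 - x k) (y k.+1 - v)) <=
    ((N + sigma * A k) * sqnorm (x k.+1 - x k) + sqnorm (v - y k.+1)) / 4.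
  by rewrite (sqnormBC v) (le_trans _ F4)// -normrN ler_norm.
have Nq : sqnorm (v - y k.+1) <= N * sqnorm (v - y k.+1).
  by rewrite ler_peMl ?sqnorm_ge0// ler1n ltnW.
lra.
Qed.

End Pathwise.

(** * Adapted runs and the averaged iterates *)

Section Averages.
Variables (R : realType) (n d : nat) (sigma Rp : R) (b : 'I_n -> 'rV[R]_d)
  (gs : 'I_n -> R -> \bar R) (l : 'rV[R]_d -> \bar R)
  (x0 : 'rV[R]_d) (y0 : 'rV[R]_n).
Hypotheses (n2 : (2 <= n)%N) (Rp0 : 0 < Rp) (sigma0 : 0 <= sigma).
Hypotheses (gsP : forall i, proper_fun (gs i) /\ convex_fun1 (gs i))
  (lP : proper_fun l) (lC : strongly_convex sigma l).

Local Notation a := (step_a n sigma Rp).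
Local Notation A := (step_A n sigma Rp).
Local Notation N := (n%:R : R).

Definition Lag_val (x : 'rV[R]_d) (y : 'rV[R]_n) : R :=
  coupling b x y - gstar_val gs y + lval l x.

Lemma LagE x y : primal_dom l x -> dual_dom gs y -> Lag b gs l x y = (Lag_val x y)%:E.
Proof. by move=> Dx Dy; rewrite /Lag gstar_fin// lE. Qed.

Lemma vrpda_real_run u v j x y z K : primal_dom l x0 -> dual_dom gs y0 ->
  vrpda_run sigma Rp b gs l x0 y0 u v j x y z K ->
  real_run sigma Rp b gs l x0 y0 u v j x y z K.
Proof.
move=> Dx0 Dy0 [[x00 y00 y1 z1 x1] step]; split=> //.
  by move=> k kK; have [] := step k.+2; rewrite ?kK.
have N0 : (0 <= N%:E)%E by rewrite lee_fin.
move=> [_|k kK]; last first.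
  have [] := step k.+2; rewrite ?kK// => ym xm _; split.
    exact: psi_minimizer ym.
  exact: phi_minimizer xm.
(* The first iterates minimize [psi_t1] and [phi_t1]; multiplication by [N] passes to the first
   estimate functions. *)
split; [apply: psi_minimizer => // w|apply: phi_minimizer => // w].
  exact: lee_wpmul2l (y1 w).
exact: lee_wpmul2l (x1 w).
Qed.

(** Allows the same iterates to be compared with another pair, in particular a saddle point. *)
Lemma real_run_shift u v u' v' j x y z K :
  real_run sigma Rp b gs l x0 y0 u v j x y z K ->
  real_run sigma Rp b gs l x0 y0 u' v' j x y z K.
Proof.
case=> x00 z1 zS mk; split=> // k kK; have [[Dy ym] [Dx xm]] := mk _ kK.
split; split=> // w Dw; rewrite -subr_ge0.
  by rewrite (psi_val_shift _ _ _ _ _ _ v' v) subr_ge0 ym.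
by rewrite (phi_val_shift _ _ _ _ _ u' u) subr_ge0 xm.
Qed.

(** Strong induction in the order of the algorithm: equal pasts give equal functions [psi], hence
    equal [y] by uniqueness, then equal [z], then equal [x]. *)
Lemma real_run_adapted u v j j' x x' y y' z z' K k :
  real_run sigma Rp b gs l x0 y0 u v j x y z K ->
  real_run sigma Rp b gs l x0 y0 u v j' x' y' z' K ->
  (k <= K)%N -> (forall i, (2 <= i <= k)%N -> j i = j' i) ->
  x k = x' k /\ ((0 < k)%N -> y k = y' k).
Proof.
move=> r r'; elim/ltn_ind: k => -[|k] IH kK jj.
  by case: r => -> _ _ _; case: r' => ->.
have IHi i : (i <= k)%N -> x i = x' i /\ ((0 < i)%N -> y i = y' i).
  move=> ik; apply: IH => //; first exact: leq_trans (leqW ik) kK.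
  by move=> m /andP[m2 mi]; apply: jj; rewrite m2 (leq_trans mi)// leqW.
have [_ _ _ /(_ _ kK)[ym xm]] := r; have [_ _ _ /(_ _ kK)[ym' xm']] := r'.
have yE : y k.+1 = y' k.+1.
  apply: (sconvex_minimizer_unique (dual_dom_convex gsP)
    (psi_val_convex b x0 y0 n2 Rp0 sigma0 gsP v j x k) _ ym).
    by rewrite ltr0n ltnW.
  have E w : psi_val sigma Rp b gs x0 y0 v j x k w = psi_val sigma Rp b gs x0 y0 v j' x' k w.
    by apply: psi_val_eq jj _ => i /IHi[].
  by split=> [|w Dw]; [exact: ym'.1|rewrite !E; exact: ym'.2].
have yy i : (0 < i <= k.+1)%N -> y i = y' i.
  move=> /andP[i0]; rewrite leq_eqVlt => /predU1P[-> //|/IHi[_]]; exact.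
have zz i : (0 < i <= k.+1)%N -> z i = z' i.
  case: i => [//|i] ik; have iK : (i < K)%N by rewrite (leq_trans _ kK).
  by rewrite (run_zE n2 Rp0 sigma0 gsP r iK) (run_zE n2 Rp0 sigma0 gsP r' iK) yy.
split=> //.
apply: (sconvex_minimizer_unique (primal_dom_convex lP lC)
  (phi_val_convex b x0 n2 Rp0 sigma0 lP lC u j y z k) _ xm).
  exact: NsA_gt0.
have E w : phi_val sigma Rp b l x0 u j y z k w = phi_val sigma Rp b l x0 u j' y' z' k w.
  apply: phi_val_eq jj yy _ _ => //; first exact: zz.
  by move=> i /andP[i0 ik]; apply: zz; rewrite i0 leqW.
by split=> [|w Dw]; [exact: xm'.1|rewrite !E; exact: xm'.2].
Qed.

Lemma sum_step_a k : \sum_(1 <= i < k.+1) a i = A k.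
Proof.
elim: k => [|k IH]; first by rewrite big_geq.
by rewrite big_nat_recr//= IH step_AS.
Qed.

Lemma dual_weighted1 k : dual_weighted n sigma Rp (fun=> 1) k = A k.+1.
Proof.
elim: k => [|k IH]; last by rewrite dual_weightedS IH [in RHS]step_AS; ring.
by rewrite /dual_weighted big_geq// step_AS mulr1 addr0 add0r.
Qed.

(** The coupling terms are linear and pass to the averages with equality; Jensen's inequality
    handles [l] and [gstar]. *)
Lemma gap_sum_bound u v (x : nat -> 'rV[R]_d) (y : nat -> 'rV[R]_n) k :
  (forall i, (0 < i <= k.+2)%N -> primal_dom l (x i)) ->
  (forall i, (0 < i <= k.+2)%N -> dual_dom gs (y i)) ->
  let xt := xtilde n sigma Rp x k.+2 in let yt := ytilde sigma Rp y k.+2 in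
  [/\ primal_dom l xt, dual_dom gs yt &
   A k.+2 * (Lag_val xt v - Lag_val u yt) <=
   gap_sum sigma Rp b gs l u v x y k.+1 - A k.+2 * gstar_val gs v - A k.+2 * lval l u].
Proof.
move=> Dx Dy xt yt; have A0 : 0 < A k.+2 by exact: step_A_gt0.
have A1 : A k.+2 != 0 by rewrite gt_eqF.
have Jx : jensen_sum (primal_dom l) (lval l) (A k.+2) (\sum_(1 <= i < k.+3) a i *: x i)
    (\sum_(1 <= i < k.+3) a i * lval l (x i)).
  rewrite -sum_step_a; apply: jensen_sum_big.
  - exact: (primal_dom_convex lP lC).
  - move=> p q al al01 Dp Dq; apply: le_trans (lval_convex lP lC al01 Dp Dq) _.
    rewrite !mul0r subr0 gerBl mulr_ge0 ?sqnorm_ge0//.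
    by case/andP: al01 => al0 al1; rewrite mulr_ge0 ?mulr_ge0//; lra.
  - by case=> [//|i] _; rewrite ltW// step_a_gt0.
  - by move=> i /andP[i1 ik]; apply: Dx; rewrite i1.
have Jy : jensen_sum (dual_dom gs) (gstar_val gs) (A k.+2)
   ((N * a k.+2) *: y k.+2 + \sum_(2 <= i < k.+2) (N * a i - (N - 1) * a i.+1) *: y i)
   (dual_weighted n sigma Rp (fun i => gstar_val gs (y i)) k.+1).
  have gc := gstar_val_convex n2 gsP; have Dc := dual_dom_convex gsP.
  (* The total dual weight is read off from [dual_weighted] at the constant function one. *)
  have -> : A k.+2 = N * a k.+2 + \sum_(2 <= i < k.+2) (N * a i - (N - 1) * a i.+1).
    rewrite -dual_weighted1 dual_weightedE// mulr1; congr (_ + _).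
    by apply: eq_bigr => i _; rewrite mulr1.
  rewrite dual_weightedE//; apply: jensen_sumD => //.
    by apply: jensen_sum1; [rewrite mulr_ge0// ltW// step_a_gt0|apply: Dy; rewrite leqnn].
  apply: jensen_sum_big => //.
  - by case=> [//|i] _; rewrite subr_ge0 step_a_growth.
  - move=> i /andP[i1 ik]; apply: Dy.
    by rewrite (ltnW i1) (ltnW ik).
case: Jx => [[E _ _]|[_ Dxt lxt]]; first by rewrite E eqxx in A1.
case: Jy => [[E _ _]|[_ Dyt gyt]]; first by rewrite E eqxx in A1.
split=> //; rewrite -/(xtilde n sigma Rp x k.+2) -/xt in lxt.
rewrite -/(ytilde sigma Rp y k.+2) -/yt in gyt.
have cx : A k.+2 * coupling b xt v = \sum_(1 <= i < k.+3) a i * coupling b (x i) v.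
  rewrite /xt /xtilde couplingZl mulrA divff// mul1r.
  have c0 : coupling b 0 v = 0 by rewrite -(scale0r 0) couplingZl mul0r.
  rewrite (big_morph (coupling b ^~ v) (fun p q => couplingDl b p q v) c0).
  by apply: eq_bigr => i _; rewrite couplingZl.
have cy : A k.+2 * coupling b u yt = dual_weighted n sigma Rp (fun i => coupling b u (y i)) k.+1.
  rewrite /yt /ytilde couplingZr mulrA divff// mul1r dual_weightedE// couplingDr couplingZr.
  have c0 : coupling b u 0 = 0 by rewrite -(scale0r 0) couplingZr mul0r.
  rewrite (big_morph (coupling b u) (fun p q => couplingDr b u p q) c0).
  by congr (_ + _); apply: eq_bigr => i _; rewrite couplingZr.
rewrite /gap_sum /primal_weighted /Lag_val.
have -> : \sum_(1 <= i < k.+3) a i * (coupling b (x i) v + lval l (x i)) =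
  \sum_(1 <= i < k.+3) a i * coupling b (x i) v + \sum_(1 <= i < k.+3) a i * lval l (x i).
  by rewrite -big_split; apply: eq_bigr => i _; rewrite mulrDr.
rewrite -cx -cy; lra.
Qed.

End Averages.

(** * Finite averages over the random indices *)

Section Expectation.
Variables (R : realType) (n K : nat).

Definition set_index (w : Omega n K) (i : 'I_K.+1) (t : 'I_n) : Omega n K :=
  [ffun m => if m == i then t else w m].

(* Exchanging [t] with the [i]-th coordinate of [w] is an involution of the
   pairs [(w, t)], whence the resampled index has the law of a fresh one. *)
Lemma sum_resample (i : 'I_K.+1) (F : Omega n K -> 'I_n -> R) : (0 < n)%N ->
  (forall w t s, F (set_index w i t) s = F w s) ->
  \sum_w (F w (w i) - n%:R^-1 * \sum_t F w t) = 0.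
Proof.
move=> n0 Fi; rewrite sumrB -mulr_sumr; apply/eqP; rewrite subr_eq0; apply/eqP.
have N0 : n%:R != 0 :> R by rewrite pnatr_eq0 -lt0n.
apply: (mulfI N0); rewrite mulrA divff// mul1r.
transitivity (\sum_(w : Omega n K) \sum_(t < n) F w (w i)).
  by rewrite mulr_sumr; apply: eq_bigr => w _; rewrite sumr_const card_ord mulr_natl.
rewrite !pair_big /=.
pose h (p : Omega n K * 'I_n) := (set_index p.1 i p.2, p.1 i).
have hh : involutive h.
  move=> [w t]; rewrite /h /=; congr (_, _); last by rewrite ffunE eqxx.
  by apply/ffunP => m; rewrite !ffunE; case: eqP => // ->.
rewrite (reindex h) /=; last by exists h => p _; rewrite hh.
by apply: eq_bigr => -[w t] _ /=; rewrite Fi ffunE eqxx.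
Qed.

Lemma card_Omega_gt0 : (0 < n)%N -> (0 < #|{: Omega n K}|)%N.
Proof. by move=> n0; rewrite card_ffun !card_ord expn_gt0 n0. Qed.

Lemma ler_Exp (F G : Omega n K -> R) : (forall w, F w <= G w) -> Exp F <= Exp G.
Proof. by move=> FG; rewrite ler_wpM2r ?invr_ge0//; apply: ler_sum. Qed.

Lemma ExpD (F G : Omega n K -> R) : Exp (fun w => F w + G w) = Exp F + Exp G.
Proof. by rewrite /Exp big_split mulrDl. Qed.

Lemma ExpZ (c : R) (F : Omega n K -> R) : Exp (fun w => c * F w) = c * Exp F.
Proof. by rewrite /Exp -mulr_sumr mulrA. Qed.

Lemma Exp_cst (c : R) : (0 < n)%N -> Exp (fun _ : Omega n K => c) = c.
Proof.
move=> n0; rewrite /Exp sumr_const -(mulr_natr c) mulfK// pnatr_eq0 -lt0n.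
exact: card_Omega_gt0.
Qed.

Lemma Exp_ge0 (F : Omega n K -> R) : (forall w, 0 <= F w) -> 0 <= Exp F.
Proof. by move=> F0; rewrite divr_ge0// sumr_ge0. Qed.

End Expectation.

(** * The bound in expectation *)

Section MainBound.
Variables (R : realType) (n d : nat) (sigma Rp : R) (b : 'I_n -> 'rV[R]_d)
  (gs : 'I_n -> R -> \bar R) (l : 'rV[R]_d -> \bar R)
  (x0 : 'rV[R]_d) (y0 : 'rV[R]_n) (K : nat)
  (x : Omega n K -> nat -> 'rV[R]_d) (y : Omega n K -> nat -> 'rV[R]_n)
  (z : Omega n K -> nat -> 'rV[R]_d).
Hypotheses (n2 : (2 <= n)%N) (Rp0 : 0 < Rp) (sigma0 : 0 <= sigma).
Hypotheses (gsP : forall i, proper_fun (gs i) /\ convex_fun1 (gs i))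
  (lP : proper_fun l) (lC : strongly_convex sigma l).
Hypothesis bR : forall i, sqnorm (b i) <= Rp ^+ 2.

Local Notation a := (step_a n sigma Rp).
Local Notation A := (step_A n sigma Rp).
Local Notation N := (n%:R : R).

Variables (u : 'rV[R]_d) (v : 'rV[R]_n).
Hypotheses (Du : primal_dom l u) (Dv : dual_dom gs v).
Hypothesis run : forall w,
  real_run sigma Rp b gs l x0 y0 u v (jseq w) (x w) (y w) (z w) K.

(** Resampling [j i] leaves the iterates before [i] unchanged, so each recentred term averages to
    zero. *)
Lemma noise_mean k : (k < K)%N ->
  \sum_w noise sigma Rp b gs v (jseq w) (x w) (y w) k = 0.
Proof.
move=> kK; rewrite /noise exchange_big /= big_nat_cond big1// => i /andP[/andP[i2 ik] _].
have iK : (i < K.+1)%N by rewrite (leq_trans ik).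
rewrite -mulr_sumr (_ : \sum_w _ = 0) ?mulr0//.
apply: (sum_resample (i := inord i)
  (F := fun w t => index_term sigma Rp b gs v (x w) (y w) i t)); first exact: ltnW.
move=> w t s.
have E m : (m < i)%N -> x (set_index w (inord i) t) m = x w m /\
    ((0 < m)%N -> y (set_index w (inord i) t) m = y w m).
  move=> mi; have mK : (m < K.+1)%N by rewrite (ltn_trans mi).
  apply: (real_run_adapted n2 Rp0 sigma0 gsP lP lC (run _) (run _)) => //.
  move=> p /andP[p2 pm]; rewrite /jseq ffunE.
  have pi : (p < i)%N by rewrite (leq_ltn_trans pm).
  case: eqP => // /(congr1 val) /=.
  by rewrite !inordK ?(ltn_trans pi)// => pE; rewrite pE ltnn in pi.
case: i i2 {ik iK} E => [|[|i]]// _ E.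
have [x1 /(_ isT) y1] := E i.+1 (ltnSn _); have [x2 _] := E i (leqnSn _).
by rewrite /index_term /xbar /= x1 x2 y1.
Qed.

Lemma averages_bound k w : (k.+2 <= K)%N ->
  let xt := xtilde n sigma Rp (x w) k.+2 in let yt := ytilde sigma Rp (y w) k.+2 in
  [/\ primal_dom l xt, dual_dom gs yt &
   A k.+2 * (Lag_val b gs l xt v - Lag_val b gs l u yt) <=
   gap_sum sigma Rp b gs l u v (x w) (y w) k.+1
   - A k.+2 * gstar_val gs v - A k.+2 * lval l u].
Proof.
move=> kK; have [_ _ _ mk] := run w.
apply: gap_sum_bound => // -[//|i] ik; have [[Dy _] [Dx _]] := mk i (leq_trans ik kK).
  exact: Dx.
exact: Dy.
Qed.

Lemma expected_bound k : (2 <= k <= K)%N ->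
  A k * Exp (fun w => Lag_val b gs l (xtilde n sigma Rp (x w) k) v
                      - Lag_val b gs l u (ytilde sigma Rp (y w) k))
  + Exp (fun w => N / 4 * sqnorm (v - y w k) + (N + sigma * A k) / 2 * sqnorm (u - x w k))
  <= N * (sqnorm (u - x0) + sqnorm (v - y0)) / 2.
Proof.
case: k => [|[|k]]//= kK; set C := (X in _ <= X).
rewrite -(Exp_cst K C (ltnW n2)) -ExpZ -ExpD.
(* The noise has mean zero, so subtracting it from the constant allows a comparison on each path. *)
have <- : Exp (fun w => C - noise sigma Rp b gs v (jseq w) (x w) (y w) k.+1) =
    Exp (fun _ : Omega n K => C).
  by rewrite /Exp sumrB noise_mean// subr0.
apply: ler_Exp => w; rewrite lerBrDr; have [_ _ G] := averages_bound w kK.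
have := pathwise_bound n2 Rp0 sigma0 gsP lP lC bR Du Dv (run w) kK.
rewrite -/C; lra.
Qed.

End MainBound.

(** * Specialisation to the gap, to a saddle point and to the growth of [A k] *)

Theorem theorem2 (R : realType) (n d : nat) (Rp sigma : R)
  (b : 'I_n -> 'rV[R]_d) (gs : 'I_n -> R -> \bar R) (l : 'rV[R]_d -> \bar R)
  (x0 : 'rV[R]_d) (y0 : 'rV[R]_n) (u : 'rV[R]_d) (v : 'rV[R]_n) (K : nat)
  (x : Omega n K -> nat -> 'rV[R]_d) (y : Omega n K -> nat -> 'rV[R]_n)
  (z : Omega n K -> nat -> 'rV[R]_d) :
  (2 <= n)%N -> 0 < Rp -> (forall i, enorm (b i) <= Rp) ->
  (forall i, [/\ proper_fun (gs i), lower_semicontinuous (gs i) & convex_fun1 (gs i)]) ->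
  0 <= sigma ->
  proper_fun l -> lower_semicontinuous l -> strongly_convex sigma l ->
  x0 \in dom l -> y0 \in dom (gstar gs) ->
  u \in dom l -> v \in dom (gstar gs) ->
  (2 <= K)%N ->
  (forall w : Omega n K,
     vrpda_run sigma Rp b gs l x0 y0 u v (jseq w) (x w) (y w) (z w) K) ->
  let A := step_A n sigma Rp in
  let c := sigma * n%:R * (n%:R - 1) / (4 * Rp) in
  let Bn := c + Num.sqrt (c ^+ 2 + n%:R ^+ 2) in
  let K0 : int := Num.ceil (ln (n%:R : R) / (ln n%:R - ln (n%:R - 1))) in
  let k0 : int := Num.ceil (ln Bn / (ln n%:R - ln (n%:R - 1))) in
  [/\ (forall k, (2 <= k <= K)%N ->
        (Expe (fun w => Gap b gs l u v (xtilde n sigma Rp (x w) k)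
                                       (ytilde sigma Rp (y w) k))
         <= (n%:R * (sqnorm (u - x0) + sqnorm (v - y0)) / (2 * A k))%:E)%E),
      (forall xs ys, saddle_point b gs l xs ys ->
        forall k, (2 <= k <= K)%N ->
          Exp (fun w => n%:R / 4 * sqnorm (ys - y w k)
                        + (n%:R + sigma * A k) / 2 * sqnorm (xs - x w k))
          <= n%:R * (sqnorm (xs - x0) + sqnorm (ys - y0)) / 2),
      (forall k, (2 <= k <= K)%N ->
        Num.max
          ((n%:R - 1) / (2 * Rp) * (1 + 1 / (n%:R - 1)) ^+ k
             * ind01 R ((k%:Z <= k0)%R))
          (Num.max
            ((n%:R - 1) ^+ 2 * sigma / ((4 * Rp) ^+ 2 * n%:R)
               * (k%:R - k0%:~R + n%:R - 1) ^+ 2 * ind01 R ((k0 <= k%:Z)%R))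
            (n%:R * (k%:R - K0%:~R + n%:R - 1) / (2 * Rp)
               * ind01 R ((K0 <= k%:Z)%R)))
        <= A k) &
      n%:R * Num.max 1 (sigma * (n%:R - 1) / (2 * Rp)) <= Bn].
Proof.
move=> n2 Rp0 bR gsP sigma0 lP _ lC x0D y0D uD vD K2 run A c Bn K0 k0.
have {}gsP i : proper_fun (gs i) /\ convex_fun1 (gs i) by case: (gsP i).
have {}bR i : sqnorm (b i) <= Rp ^+ 2 by exact: sqnorm_le_enorm.
move: x0D y0D uD vD => /(dom_l lP) x0D /(dom_gstar n2 gsP) y0D.
move=> /(dom_l lP) uD /(dom_gstar n2 gsP) vD.
have {}run w := vrpda_real_run n2 Rp0 sigma0 gsP lP x0D y0D (run w).
split.
- move=> k kK; have A0 : 0 < A k.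
    by case: k kK => [//|k] _; exact: step_A_gt0.
  have kE w : Gap b gs l u v (xtilde n sigma Rp (x w) k) (ytilde sigma Rp (y w) k) =
      (Lag_val b gs l (xtilde n sigma Rp (x w) k) v
       - Lag_val b gs l u (ytilde sigma Rp (y w) k))%:E.
    case: k kK {A0} => [|[|k]]//= kK.
    have [Dx Dy _] := averages_bound n2 Rp0 sigma0 gsP lP lC run w kK.
    by rewrite /Gap !LagE.
  have := expected_bound n2 Rp0 sigma0 gsP lP lC bR uD vD run kK.
  rewrite /Expe (eq_bigr _ (fun w _ => kE w)) sumEFin -EFinM lee_fin -/(Exp _).
  set E1 := Exp _; set E2 := Exp _ => EB.
  (* The distance terms are nonnegative and are dropped before dividing by [A k]. *)
  have E20 : 0 <= E2.
    apply: Exp_ge0 => w; rewrite addr_ge0// mulr_ge0 ?sqnorm_ge0 ?divr_ge0//.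
    by rewrite ltW// NsA_gt0.
  rewrite invfM mulrA ler_pdivlMr// [X in X <= _]mulrC -/A; lra.
- move=> xs ys [xsD [ysD saddle]] k kK.
  have Dxs : primal_dom l xs by apply/(dom_l lP).
  have Dys : dual_dom gs ys by apply/(dom_gstar n2 gsP).
  (* At a saddle point the gap is nonnegative, so here the gap term is dropped and the distances are
     kept. *)
  have run' w := real_run_shift xs ys (run w).
  have := expected_bound n2 Rp0 sigma0 gsP lP lC bR Dxs Dys run' kK.
  rewrite -/A; apply: le_trans; rewrite lerDr mulr_ge0 ?step_A_ge0//.
  apply: Exp_ge0 => w; case: k kK => [|[|k]]//= kK.
  have [Dx Dy _] := averages_bound n2 Rp0 sigma0 gsP lP lC run' w kK.
  have /andP[] := saddle _ _ (proj2 (dom_l lP _) Dx) (proj2 (dom_gstar n2 gsP _) Dy).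
  rewrite !LagE// !lee_fin => h1 h2; rewrite subr_ge0; exact: le_trans h1 h2.
- move=> k /andP[k2 _]; rewrite /ind01 !ge_max; apply/and3P; split.
  + case: ifP => [kk0|_]; last by rewrite mulr0 step_A_ge0.
    by rewrite mulr1; apply: step_A_ge_geometric => //; exact: ltnW.
  + case: ifP => [kk0|_]; last by rewrite mulr0 step_A_ge0.
    by rewrite mulr1; exact: step_A_ge_quadratic.
  + case: ifP => [kk0|_]; last by rewrite mulr0 step_A_ge0.
    by rewrite mulr1; exact: step_A_ge_linear.
- exact: Bn_ge.
Qed.
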